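(* Let $X$ be a smooth projective split toric variety over $\mathbb{Q}$ with $-K_X$ globally generated, $r=\operatorname{rank}\operatorname{Pic}(X)$, $n=\#\Delta(1)$. Let $f,g\in\mathbb{Z}[x_\rho:\rho\in\Delta(1)]$ be coprime, i.e. the subscheme $f=g=0$ has codimension $2$ in $\mathbb{A}^n_\mathbb{Q}$. Then uniformly for $N\ge2$, $$\#\{\mathbf{X}\in\mathcal{A}(B):\exists\text{ prime }p\ge N,\ p\mid\gcd(f(\mathbf{X}),g(\mathbf{X}))\}\ll_{f,g}\frac{B(\log B)^{r-1}}{N\log N}+B(\log B)^{r-2}\log\log B.$$
   Context: $X$ is defined by a complete regular fan $\Delta$ in $N_\mathbb{R}$ ($M$ the dual lattice); $\Delta(1)$ is the set of rays with primitive generators $n_\rho$, $\Delta_{\max}$ the maximal cones. For $\sigma\in\Delta_{\max}$, $m_\sigma\in M$ is the unique element with $\langle m_\sigma,n_\rho\rangle=1$ for all rays $\rho$ of $\sigma$, and $a_\rho(\sigma)=1-\langle m_\sigma,n_\rho\rangle\ge0$. For $\mathbf{X}=(X_\rho)$ with positive entries, $\mathbf{X}^{D_0(\sigma)}=\prod_\rho X_\rho^{a_\rho(\sigma)}$, and $\mathcal{A}(B)=\{\mathbf{X}\in\mathbb{Z}_{\ge1}^{\Delta(1)}:\max_{\sigma\in\Delta_{\max}}\mathbf{X}^{D_0(\sigma)}\le B\}$. *)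

(* Defs.v *)
From HB Require Import structures.
From mathcomp Require Import all_boot all_order all_algebra.
From mathcomp Require Import boolp reals exp.
From mathcomp Require Import mpoly.

Set Implicit Arguments.
Unset Strict Implicit.
Unset Printing Implicit Defensive.

Import Order.TTheory GRing.Theory Num.Theory.
Local Open Scope ring_scope.

(* A fan in N_R = R^d, N = Z^d, is given by
   - n rays rho : 'I_n with primitive generators nv rho : 'I_d -> int,
   - the set Dmax : {set {set 'I_n}} of maximal cones, each maximal cone
     sigma being described by the set of rays it contains.
   M = Z^d is the dual lattice with the standard pairing. *)

Section Toric.
Variables (n d : nat).
Implicit Types (nv : 'I_n -> 'I_d -> int) (Dmax : {set {set 'I_n}}).

Definition pairing (m v : 'I_d -> int) : int := \sum_(i < d) m i * v i.

Definition cone (R : realType) nv (S : {set 'I_n}) : ('I_d -> R) -> Prop :=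
  fun x => exists lam : 'I_n -> R, (forall rho, 0 <= lam rho) /\
    forall i, x i = \sum_(rho in S) lam rho * (nv rho i)%:~R.

Definition Zbasis nv (S : {set 'I_n}) : Prop :=
  (forall v : 'I_d -> int, exists c : 'I_n -> int,
      forall i, v i = \sum_(rho in S) c rho * nv rho i) /\
  (forall c c' : 'I_n -> int,
      (forall i, \sum_(rho in S) c rho * nv rho i = \sum_(rho in S) c' rho * nv rho i) ->
      forall rho, rho \in S -> c rho = c' rho).

Definition complete_regular_fan (R : realType) nv Dmax : Prop :=
  [/\ injective nv,
      (forall rho, exists2 sigma, sigma \in Dmax & rho \in sigma),
      (forall sigma, sigma \in Dmax -> Zbasis nv sigma),
      (* cones meet along common faces *)
      (forall sigma sigma', sigma \in Dmax -> sigma' \in Dmax ->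
         forall x, (@cone R nv sigma x /\ @cone R nv sigma' x) <-> @cone R nv (sigma :&: sigma') x)
    &
      (forall x : 'I_d -> R, exists2 sigma, sigma \in Dmax & @cone R nv sigma x)].

(* Projectivity: there is an ample (strictly convex) torus-invariant Cartier
   divisor, i.e. integers b_rho and m'_sigma in M with <m'_sigma, n_rho> = b_rho
   for rho in sigma and <m'_sigma, n_rho> < b_rho for rho not in sigma. *)
Definition projective_fan nv Dmax : Prop :=
  exists (b : 'I_n -> int) (m : {set 'I_n} -> 'I_d -> int),
    forall sigma, sigma \in Dmax ->
      (forall rho, rho \in sigma -> pairing (m sigma) (nv rho) = b rho) /\
      (forall rho, rho \notin sigma -> pairing (m sigma) (nv rho) < b rho).

(* m_sigma : the unique element of M with <m_sigma, n_rho> = 1 for rho in sigma *)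
Definition msig nv (sigma : {set 'I_n}) : {ffun 'I_d -> int} :=
  match pselect (exists m : {ffun 'I_d -> int},
                   forall rho, rho \in sigma -> pairing m (nv rho) = 1) with
  | left h => sval (cid h)
  | right _ => [ffun => 0]
  end.

Definition acoef nv (sigma : {set 'I_n}) (rho : 'I_n) : int :=
  1 - pairing (msig nv sigma) (nv rho).

(* -K_X is globally generated: a_rho(sigma) >= 0 for all maximal sigma, all rho *)
Definition antican_gg nv Dmax : Prop :=
  forall sigma rho, sigma \in Dmax -> 0 <= acoef nv sigma rho.

(* rank Pic(X) = rank of coker(M -> Z^{Delta(1)}, m |-> (<m, n_rho>)_rho) *)
Definition rank_pic nv : nat :=
  (n - \rank (\matrix_(rho < n, i < d) ((nv rho i)%:~R : rat)))%N.

Definition XD0 (R : realType) nv (sigma : {set 'I_n}) (X : {ffun 'I_n -> nat}) : R :=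
  \prod_(rho < n) ((X rho)%:R ^ acoef nv sigma rho).

Definition height (R : realType) nv Dmax (X : {ffun 'I_n -> nat}) : R :=
  \big[Num.max/0]_(sigma in Dmax) XD0 R nv sigma X.

Definition inA (R : realType) nv Dmax (B : R) (X : {ffun 'I_n -> nat}) : Prop :=
  (forall rho, (1 <= X rho)%N) /\ height R nv Dmax X <= B.

Definition evalZ (f : mpoly.mpoly n int) (X : {ffun 'I_n -> nat}) : int :=
  mpoly.meval (fun rho => (X rho)%:Z) f.

(* f, g coprime: every common divisor of f and g in Q[x_rho] is constant
   (equivalently, V(f, g) has codimension 2 in A^n_Q). *)
Definition coprime_mpoly (f g : mpoly.mpoly n int) : Prop :=
  forall h q1 q2 : mpoly.mpoly n rat,
    mpoly.map_mpoly (intr : int -> rat) f = h * q1 ->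
    mpoly.map_mpoly (intr : int -> rat) g = h * q2 ->
    (mpoly.mmeasure mpoly.mdeg h <= 1)%N.

End Toric.

Arguments cone {n d} R nv S x.
Arguments complete_regular_fan {n d} R nv Dmax.
Arguments XD0 {n d} R nv sigma X.
Arguments height {n d} R nv Dmax X.
Arguments inA {n d} R nv Dmax B X.

(* Main.v *)
(* Write each X in A(B) dyadically, 2^(k_rho) <= X_rho < 2^(k_rho + 1).  Choosing
   a maximal cone sigma that contains v = - sum_rho k_rho n_rho, with coordinates
   c_rho >= 0 there, the height condition at sigma reads |k| + |c| <= log_2 B.
   Taking c and the k_rho with rho outside sigma as new variables,
   sum_k 2^|k| << B (log B)^(r-1); freezing one k_rho0 saves a factor log B: either
   it is linearly independent of |k| on the relations between the rays, or it is
   proportional to |k| there, and then a small k_rho0 forces |k| <= (1 - e) log_2 B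
   up to a bounded multiple of k_rho0.  Hence the X having some coordinate
   smaller than (log B)^2 contribute O(B (log B)^(r-2) log log B).

   In a dyadic box whose sides all lie between m and 2^L, the bad points number
   << Vol (sum_(p >= N) p^-2 + L / m), by induction on the number of variables.
   The ideal of a coprime family contains a nonzero h free of the variable x_0
   (Gauss's lemma).  If p divides all values at X, then either p divides all
   the coefficients with respect to x_0, which is the induction hypothesis, or
   p | h and x_0 is one of boundedly many residues mod p.  There are O(1/p^2) such
   points for p <= m; for p > m, either h = 0, or h has only O(L) prime factors. *)

Require Import Defs.
From HB Require Import structures.
From mathcomp Require Import all_boot all_order all_algebra.
From mathcomp Require Import ring lra zify.
From mathcomp Require Import boolp reals exp.
From mathcomp Require sequences.
From mathcomp Require Import mpoly.

Set Implicit Arguments.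
Unset Strict Implicit.
Unset Printing Implicit Defensive.

Import Order.TTheory GRing.Theory Num.Theory.
Local Open Scope ring_scope.

(** * Factorial rings and elimination of a variable *)

Section Divisibility.
Variable R : idomainType.
Implicit Types a b c p : R.

Definition rdvd a b := exists c, b = c * a.

Definition prime_elt p :=
  [/\ p != 0, p \isn't a GRing.unit
    & forall a b, rdvd p (a * b) -> rdvd p a \/ rdvd p b].

(** Unique factorization in the form the inductions use: [mu] drops strictly when a nonunit factor
    is removed, so splitting off prime elements terminates. *)
Definition factorial_ring :=
  (exists mu : R -> nat, forall a b, a * b != 0 ->
     (mu b <= mu (a * b)%R)%N /\ (a \isn't a GRing.unit -> (mu b < mu (a * b)%R)%N)) /\
  (forall a, a != 0 -> a \isn't a GRing.unit -> exists2 p, prime_elt p & rdvd p a).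

Lemma rdvd_mull a b c : rdvd a b -> rdvd a (c * b).
Proof. by move=> [d ->]; exists (c * d); rewrite mulrA. Qed.

Lemma rdvd_mulr a b c : rdvd a b -> rdvd a (b * c).
Proof. by rewrite mulrC; apply: rdvd_mull. Qed.

Lemma rdvd_add a b c : rdvd a b -> rdvd a c -> rdvd a (b + c).
Proof. by move=> [d ->] [e ->]; exists (d + e); rewrite mulrDl. Qed.

Lemma rdvd_sub a b c : rdvd a b -> rdvd a c -> rdvd a (b - c).
Proof. by move=> [d ->] [e ->]; exists (d - e); rewrite mulrBl. Qed.

Lemma rdvd_trans a b c : rdvd a b -> rdvd b c -> rdvd a c.
Proof. by move=> [d ->] [e ->]; exists (e * d); rewrite mulrA. Qed.

Lemma rdvd0 a : rdvd a 0.
Proof. by exists 0; rewrite mul0r. Qed.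

Lemma rdvdd a : rdvd a a.
Proof. by exists 1; rewrite mul1r. Qed.

End Divisibility.

Section FactorialPoly.
Variable R : idomainType.
Implicit Types (a b c p : R) (d e f u v w : {poly R}).

Lemma rdvd_polyC p f : rdvd p%:P f <-> forall i, rdvd p f`_i.
Proof.
split=> [[g ->] i|/choice [c cE]]; first by rewrite coefMC; exists g`_i.
exists (\poly_(i < size f) c i); apply/polyP => i; rewrite coefMC coef_poly.
by case: ltnP => [_|le]; rewrite -?cE // nth_default // mul0r.
Qed.

(** Gauss's lemma. If [p] divides [f * g], it divides one of the leading coefficients; stripping
    that leading term keeps the divisibility and lowers the sum of the sizes. *)
Lemma prime_elt_polyC p : prime_elt p -> prime_elt p%:P.
Proof.
move=> [p0 pU pP]; split; first by rewrite polyC_eq0.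
  by rewrite poly_unitE coefC eqxx negb_and pU orbT.
move=> f g; have [k] := ubnP (size f + size g)%N.
elim: k f g => // k IH f g lek pfg.
have [->|f0] := eqVneq f 0; first by left; exact: rdvd0.
have [->|g0] := eqVneq g 0; first by right; exact: rdvd0.
pose low (h : {poly R}) := h - lead_coef h *: 'X^((size h).-1).
have lowE (h : {poly R}) : h = low h + lead_coef h *: 'X^((size h).-1) by rewrite subrK.
have size_low (h : {poly R}) : h != 0 -> (size (low h) < size h)%N.
  move=> h0; rewrite /low; have sh : (0 < size h)%N by rewrite size_poly_gt0.
  rewrite -[X in (_ < X)%N](prednK sh) ltnS; apply/leq_sizeP => j.
  rewrite coefB coefZ coefXn leq_eqVlt => /predU1P[<-|lt].
    by rewrite eqxx mulr1 subrr.
  rewrite gtn_eqF // mulr0 subr0 nth_default //.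
  by rewrite -(prednK sh).
have lc (h : {poly R}) : rdvd p (lead_coef h) -> rdvd p%:P (lead_coef h *: 'X^((size h).-1)).
  by move=> ph; apply/rdvd_polyC => i; rewrite coefZ; apply: rdvd_mulr.
have : rdvd p (lead_coef f * lead_coef g).
  by rewrite -lead_coefM; apply: (rdvd_polyC p _).1 pfg _.
case/pP => /lc H.
- have [||H1|H1] := IH (low f) g; last by right.
  + by rewrite -ltnS (leq_trans _ lek) // ltnS ltn_add2r size_low.
  + by rewrite mulrBl; apply: rdvd_sub => //; apply: rdvd_mulr.
  + by left; rewrite [f]lowE; apply: rdvd_add.
- have [||H1|H1] := IH f (low g); first 1 last.
  + by rewrite mulrBr; apply: rdvd_sub => //; apply: rdvd_mull.
  + by left.
  + by right; rewrite [g]lowE; apply: rdvd_add.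
  + by rewrite -ltnS (leq_trans _ lek) // ltnS ltn_add2l size_low.
Qed.

(** The ideal generated by [F], as the intersection of all ideals containing it; a property stable
    under the ideal operations passes from [F] to [w] by mere application. *)
Definition in_ideal (F : {poly R} -> Prop) w :=
  forall J : {poly R} -> Prop, J 0 -> (forall x y, J x -> J y -> J (x + y)) ->
    (forall v x, J x -> J (v * x)) -> (forall f, F f -> J f) -> J w.

Hypothesis Rfact : factorial_ring R.

(* Denominators are removed one prime factor at a time: a prime dividing
   [d * q] for every [q] divides [d] or all the [q]. *)
Lemma clear_denominators (F : {poly R} -> Prop) a e :
  a != 0 -> e != 0 -> (forall f, F f -> rdvd e (a *: f)) ->
  exists b e', e = b *: e' /\ forall f, F f -> rdvd e' f.
Proof.
have [[mu muP] primeP] := Rfact; move=> a0.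
have [k] := ubnP (mu a); elim: k a a0 e => // k IH a a0 e lek e0 H.
have [aU|aN] := boolP (a \is a GRing.unit).
  exists 1, e; rewrite scale1r; split=> // f /H [q qE].
  by exists (a^-1 *: q); rewrite -scalerAl -qE scalerA mulVr // scale1r.
have [p pp [a' aE]] := primeP a a0 aN.
have [pP0 pU pM] := pp.
have a'0 : a' != 0 by apply: contraNneq a0 => E; rewrite aE E mul0r.
have lt : (mu a' < k)%N.
  rewrite -ltnS (leq_trans _ lek) // ltnS aE mulrC.
  by have [|_ ->] // := muP p a'; rewrite mulrC -aE.
have scaleI (x y : {poly R}) : p *: x = p *: y -> x = y.
  by rewrite -!mul_polyC; apply: mulfI; rewrite polyC_eq0.
have [pe|npe] := pselect (rdvd p%:P e).
  have [e' eE] := pe; rewrite mulrC mul_polyC in eE.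
  have e'0 : e' != 0 by apply: contraNneq e0 => E; rewrite eE E scaler0.
  have [|b [e'' [E1 E2]]] := IH a' a'0 e' lt e'0; last first.
    by exists (p * b), e''; rewrite eE E1 scalerA.
  move=> f /H [q qE]; exists q; apply: scaleI.
  by rewrite scalerA mulrC -aE qE eE scalerAr.
apply: (IH a' a'0 e lt e0) => f /H [q qE].
have [_ _ pPM] := prime_elt_polyC pp.
have [|[q' q'E]|//] := pPM q e.
  by exists (a' *: f); rewrite -qE mulrC mul_polyC scalerA mulrC -aE.
exists q'; apply: scaleI.
by rewrite scalerA mulrC -aE qE q'E mulrAC mulrC mul_polyC.
Qed.

(** Take for [e] a nonzero element of least size in the ideal: the pseudo-remainder of each [f] by
    [e] is in the ideal and smaller, hence zero. Clearing denominators turns divisibility up to a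
    scalar into divisibility by [e']. *)
Lemma ideal_gcd (F : seq {poly R}) : has (predC1 0) F ->
  exists e b e', [/\ in_ideal (fun f => f \in F) e, e != 0, e = b *: e'
    & forall f, f \in F -> rdvd e' f].
Proof.
move=> /hasP[f0 Ff0 /= f0N].
pose I := in_ideal (fun f => f \in F).
have FI f : f \in F -> I f by move=> Ff J _ _ _; apply.
pose P k := `[< exists w, [/\ I w, w != 0 & size w = k] >].
have exP : exists k, P k.
  by exists (size f0); apply/asboolP; exists f0; split=> //; apply: FI.
case: (ex_minnP exP) => k /asboolP[e [Ie e0 ek]] kmin.
have red f : f \in F -> rdvd e (lead_coef e ^+ scalp f e *: f).
  move=> Ff; exists (f %/ e).
  have E := Pdiv.Idomain.divp_eq f e.
  suff r0 : (f %% e) = 0 by rewrite E r0 addr0.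
  apply/eqP/negPn/negP => r0.
  have := kmin (size (f %% e)); rewrite -ek leqNgt Pdiv.Idomain.ltn_modpN0 // => H.
  suff /H : P (size (f %% e)) by [].
  apply/asboolP; exists (f %% e); split=> //.
  have -> : (f %% e) = (lead_coef e ^+ scalp f e)%:P * f + (- (f %/ e)) * e.
    by rewrite mul_polyC E mulNr addrAC subrr add0r.
  move=> J J0 JD JM JF; by apply: (JD); apply: (JM); [apply: JF | apply: Ie].
(* The power of the leading coefficient in pseudo-division depends on [f]; the sum of the exponents
   serves for all of [F]. *)
pose s := (\sum_(f <- F) scalp f e)%N.
have [||f Ff|b [e' [E1 E2]]] := @clear_denominators (fun f => f \in F) (lead_coef e ^+ s) e.
- by rewrite expf_neq0 // lead_coef_eq0.
- by [].
- have [c cE] := red _ Ff.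
  have le : (scalp f e <= s)%N by rewrite /s (big_rem f) //= leq_addr.
  exists (lead_coef e ^+ (s - scalp f e) *: c).
  by rewrite -(subnK le) exprD -scalerA cE scalerAl addnK.
by exists e, b, e'.
Qed.

End FactorialPoly.

(** The measure adds the size and the measure of the leading coefficient. If no constant prime
    divides [f], all its divisors are primitive, and a nonconstant divisor of least size is prime by
    a Bezout argument. *)
Lemma factorial_poly (R : idomainType) :
  factorial_ring R -> factorial_ring {poly R}.
Proof.
move=> Rfact; have [[mu muP] primeP] := Rfact; split.
  exists (fun f : {poly R} => size f + mu (lead_coef f))%N => a b ab0.
  have [a0 b0] : a != 0 /\ b != 0 by apply/andP; rewrite -negb_or -mulf_eq0.
  have sa : (0 < size a)%N by rewrite size_poly_gt0.
  have [le lt] : (mu (lead_coef b) <= mu (lead_coef a * lead_coef b)%R)%N /\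
      (lead_coef a \isn't a GRing.unit ->
       (mu (lead_coef b) < mu (lead_coef a * lead_coef b)%R)%N).
    by apply: muP; rewrite mulf_neq0 // lead_coef_eq0.
  rewrite size_mul // lead_coefM -(prednK sa) addSn /=.
  split=> [|aN]; first exact: leq_add (leq_addl _ _) le.
  have [sa1|sa1] := posnP (size a).-1; last first.
    by rewrite -addSn leq_add // -{1}[size b]add0n ltn_add2r.
  rewrite sa1 add0n ltn_add2l lt //; apply: contra aN => aU.
  by rewrite poly_unitE -(prednK sa) sa1 /=; rewrite lead_coefE sa1 in aU.
move=> f f0 fN.
have [[p pp pf]|npf] := pselect (exists2 p, prime_elt p & rdvd p%:P f).
  by exists p%:P => //; apply: prime_elt_polyC.
have primitive (d : {poly R}) c : rdvd d f -> rdvd c%:P d -> c \is a GRing.unit.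
  move=> df cd; apply/negPn/negP => cN; apply: npf.
  have cf := rdvd_trans cd df.
  have c0 : c != 0.
    by apply: contraNneq f0 => c0; case: cf => e ->; rewrite c0 mulr0.
  have [p pp pc] := primeP c c0 cN; exists p => //.
  apply: rdvd_trans cf; case: pc => e ->.
  by exists e%:P; rewrite polyCM.
pose P k := `[< exists d, [/\ rdvd d f, (1 < size d)%N & size d = k] >].
have exP : exists k, P k.
  exists (size f); apply/asboolP; exists f; split=> //; first exact: rdvdd.
  rewrite ltnNge; apply: contra fN => /size1_polyC fE.
  by rewrite fE poly_unitE size_polyC coefC /= (primitive f _ (rdvdd f)) ?andbT;
     [rewrite -polyC_eq0 -fE f0 | rewrite -fE; apply: rdvdd].
case: (ex_minnP exP) => k /asboolP[d [df sd dk]] kmin.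
have d0 : d != 0 by rewrite -size_poly_gt0 (ltn_trans _ sd).
exists d => //; split=> //.
  by rewrite poly_unitE gtn_eqF.
move=> u v duv.
have [|e [b [e' [Ie e0 eE e'd]]]] := @ideal_gcd R Rfact [:: d; u].
  by rewrite /= d0.
have e'0 : e' != 0 by apply: contraNneq e0 => E; rewrite eE E scaler0.
(* A nonconstant common divisor [e'] of [d] and [u] has the size of [d] by minimality, so it is [d]
   up to a unit and [d] divides [u]. If [e'] is constant, so is [e], and the Bezout relation makes
   [d] divide [e * v]. *)
have [se'|se'] := ltnP 1 (size e').
  left; have /e'd ed : d \in [:: d; u] by rewrite inE eqxx.
  have /e'd eu : u \in [:: d; u] by rewrite !inE eqxx orbT.
  case: (ed) => w dE.
  have w0 : w != 0 by apply: contraNneq d0 => E; rewrite dE E mul0r.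
  have : (k <= size e')%N.
    by apply: kmin; apply/asboolP; exists e'; split=> //; apply: rdvd_trans df.
  rewrite -dk {1}dE size_mul // => le.
  have /size1_polyC wE : (size w <= 1)%N.
    by move: le; rewrite -subn1 leq_subLR leq_add2r.
  have wU : w`_0 \is a GRing.unit.
    by apply: (primitive d) => //; exists e'; rewrite -wE mulrC.
  case: eu => z ->; exists ((w`_0)^-1 *: z).
  by rewrite dE {2}wE mul_polyC -scalerAr -scalerAl scalerA mulrV // scale1r.
right.
have dev : rdvd d (e * v).
  apply: (Ie (fun w => rdvd d (w * v))).
  - by rewrite mul0r; apply: rdvd0.
  - by move=> x y dx dy; rewrite mulrDl; apply: rdvd_add.
  - by move=> x y dy; rewrite -mulrA; apply: rdvd_mull.
  - move=> g; rewrite !inE => /orP[] /eqP -> //.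
    by apply: rdvd_mulr; apply: rdvdd.
pose c := b * e'`_0.
have ec : e = c%:P by rewrite eE polyCM -mul_polyC (size1_polyC se') coefC.
(* Cancelling the constant [c] replaces [d] by [d'], which differs from [d] by a unit because [d] is
   primitive. *)
have [||g|b' [d' [dE d'v]]] := @clear_denominators R Rfact (fun g => g = v) c d.
- by rewrite -polyC_eq0 -ec.
- by [].
- by move=> ->; rewrite -mul_polyC -ec.
have b'U : b' \is a GRing.unit.
  by apply: (primitive d) => //; exists d'; rewrite dE -mul_polyC mulrC.
have [z ->] := d'v v erefl; exists (b'^-1 *: z).
by rewrite dE -scalerAr -scalerAl scalerA mulrV // scale1r.
Qed.

Lemma factorial_int : factorial_ring int.
Proof.
have unitE (a : int) : (a \is a GRing.unit) = (absz a == 1%N) by case: a => [[|[|]]|[|]].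
split.
  exists absz => a b; rewrite mulf_eq0 negb_or -!absz_gt0 => /andP[a0 b0].
  rewrite abszM unitE; split=> [|aN]; first exact: leq_pmull.
  by rewrite ltn_Pmull // ltn_neqAle eq_sym aN.
move=> a a0; rewrite unitE => aN.
have a1 : (1 < absz a)%N by rewrite ltn_neqAle eq_sym aN absz_gt0.
have pp := pdiv_prime a1.
have dvdE (b : int) : rdvd (pdiv (absz a))%:Z b <-> (pdiv (absz a) %| absz b)%N.
  by rewrite -[X in (X %| _)%N]absz_nat; split=> [[c ->]|/dvdzP //]; rewrite abszM dvdn_mull.
exists (pdiv (absz a))%:Z; last by apply/dvdE; apply: pdiv_dvd.
split; first by rewrite -absz_gt0 prime_gt0.
  by rewrite unitE; apply: contraTneq pp => /= ->.
by move=> b c /dvdE; rewrite abszM Euclid_dvdM // => /orP[] /dvdE; [left|right].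
Qed.

(* [Z[x_0, ..., x_(n-1)]] with [x_0] as the outermost variable. *)
Fixpoint zpoly (n : nat) : idomainType :=
  if n is m.+1 then {poly (zpoly m)} : idomainType else int.

Lemma factorial_zpoly n : factorial_ring (zpoly n).
Proof. by elim: n => [|n IH]; [apply: factorial_int | apply: factorial_poly]. Qed.

(** The head of the list goes to the outermost variable; a list that is too short is padded with
    zeros. *)
Fixpoint zeval (S : comNzRingType) (n : nat) : seq S -> {rmorphism zpoly n -> S} :=
  match n return seq S -> {rmorphism zpoly n -> S} with
  | 0%N => fun=> (intr : {rmorphism int -> S})
  | m.+1 => fun X => (horner_eval (head 0 X) \o map_poly (zeval m (behead X))
                        : {rmorphism {poly zpoly m} -> S})
  end.
Arguments zeval {S} n X.

(** Coprimality over the rationals: a common factor may be any integer constant, not only a unit. *)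
Definition zcoprime n (F : seq (zpoly n)) :=
  forall h, (forall f, f \in F -> rdvd h f) -> exists c : int, h = c%:~R.

(** The common divisor [e'] is an integer, so the ideal element [e], a scalar multiple of it, is
    free of the outermost variable. *)
Lemma elimination n (F : seq (zpoly n.+1)) : has (predC1 0) F -> zcoprime F ->
  exists2 h : zpoly n, h != 0 & in_ideal (fun f : {poly zpoly n} => f \in F) h%:P.
Proof.
move=> F0 Fc.
have [e [b [e' [Ie e0 eE e'F]]]] := ideal_gcd (factorial_zpoly n) F0.
have [c cE] := Fc e' e'F.
have E : e = (b * c%:~R)%:P.
  rewrite eE cE polyCM -mul_polyC; congr (_ * _); exact: (esym (rmorph_int polyC c)).
by exists (b * c%:~R); rewrite -?E // -polyC_eq0 -E.
Qed.

Definition zcoefs n (F : seq (zpoly n.+1)) : seq (zpoly n) :=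
  flatten [seq polyseq (f : {poly zpoly n}) | f <- F].

Lemma mem_zcoefs n (F : seq (zpoly n.+1)) (f : {poly zpoly n}) i :
  f \in F -> (i < size f)%N -> f`_i \in zcoefs F.
Proof.
move=> Ff lt; apply/flattenP; exists (polyseq f); last exact: mem_nth.
by apply/mapP; exists f.
Qed.

Lemma zcoefs_neq0 n (F : seq (zpoly n.+1)) :
  has (predC1 0) F -> has (predC1 0) (zcoefs F).
Proof.
move=> /hasP[/= f Ff f0]; apply/hasP; exists (lead_coef (f : {poly zpoly n})).
  by apply: mem_zcoefs; rewrite // prednK // size_poly_gt0.
by rewrite /= lead_coef_eq0.
Qed.

(** A common divisor of all coefficients, seen as a constant polynomial, divides the whole family.
    This drives the induction on the number of variables. *)
Lemma zcoprime_coefs n (F : seq (zpoly n.+1)) : zcoprime F -> zcoprime (zcoefs F).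
Proof.
move=> Fc h hF; have [f Ff|c cE] := Fc (h%:P : {poly zpoly n}).
  apply/(@rdvd_polyC (zpoly n) h f) => i.
  have [lt|ge] := ltnP i (size (f : {poly zpoly n})).
    by apply: hF; apply: mem_zcoefs.
  by rewrite nth_default //; apply: rdvd0.
exists c; apply: (@polyC_inj (zpoly n)); rewrite cE.
exact: (esym (rmorph_int (@polyC (zpoly n)) c)).
Qed.

(** * The sieve in a box *)

Lemma sum_nat_of_bool (A : Type) (P : pred A) (s : seq A) :
  (\sum_(x <- s) P x = count P s)%N.
Proof. by elim: s => [|x s IH]; rewrite ?big_nil // big_cons IH. Qed.

Lemma count_cover (A B : Type) (P : pred A) (Q : B -> pred A) (s : seq A) (ps : seq B) :
  (forall x, P x -> has (Q^~ x) ps) ->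
  (count P s <= \sum_(p <- ps) count (Q p) s)%N.
Proof.
move=> PQ; elim: s => [|x s IH] //=.
rewrite big_split /= leq_add // {IH}.
case Px: (P x) => //=; have := PQ x Px; elim: ps {PQ} => [|p ps IH] //=.
by rewrite big_cons; case: (Q p x) => //= /IH.
Qed.

Fixpoint box (T : seq nat) : seq (seq nat) :=
  if T is t :: T' then [seq x :: X | X <- box T', x <- iota 0 t] else [:: [::]].

Lemma count_box P t T :
  count P (box (t :: T)) = (\sum_(X <- box T) count (fun x => P (x :: X)) (iota 0 t))%N.
Proof.
rewrite /= count_flatten -map_comp sumnE big_map.
by apply: eq_bigr => X _ /=; rewrite count_map.
Qed.

Lemma size_box T : size (box T) = (\prod_(t <- T) t)%N.
Proof.
elim: T => [|t T IH]; first by rewrite big_nil.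
by rewrite /= size_allpairs IH size_iota big_cons mulnC.
Qed.

Lemma size_in_box T X : X \in box T -> size X = size T.
Proof. by elim: T X => [|t T IH] X; [rewrite inE => /eqP->|case/allpairsP=> -[Y x] /= [/IH <- _ ->]]. Qed.

Lemma mem_box T X : size X = size T -> (forall i, i < size T -> nth 0 X i < nth 0 T i)%N ->
  X \in box T.
Proof.
elim: T X => [|t T IH] [|x X] //= [sX] lt.
apply/allpairsP; exists (X, x); split=> //=; last by rewrite mem_iota (lt 0%N).
by apply: IH => // i; apply: (lt i.+1).
Qed.

(* [K = int], or [K = 'F_p] with [m <= p]: reduction to [K] is injective near
   [0], and residues are equidistributed, at all scales down to [m]. *)
Definition separated (K : idomainType) (m : nat) :=
  (forall z : int, z != 0 -> z%:~R = 0 :> K -> (m <= absz z)%N) /\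
  (forall (y : K) t, (m <= t)%N -> (m * count (fun x => x%:R == y) (iota 0 t) <= 2 * t)%N).

Lemma separated_int m : separated int m.
Proof.
split=> [z z0|y t mt]; first by rewrite intz => zE; rewrite zE eqxx in z0.
have le1 : (count (fun x => x%:R == y) (iota 0 t) <= 1)%N.
  have [/hasP[x _ /eqP <-]|] := boolP (has (fun x => (x%:R : int) == y) (iota 0 t)); last first.
    by rewrite has_count -leqNgt => /leq_trans -> .
  rewrite (@eq_count _ _ (pred1 x)) => [|z /=]; first by rewrite count_uniq_mem ?iota_uniq ?leq_b1.
  by rewrite eqr_nat.
by rewrite (leq_trans (leq_mul mt le1)) // muln1 leq_pmull.
Qed.

Lemma separated_Fp m p : prime p -> (m <= p)%N -> separated 'F_p m.
Proof.
move=> pp mp; split=> [z z0 /eqP|y t mt].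
  rewrite -(dvdz_pcharf (pchar_Fp pp)) => /dvdn_leq; rewrite absz_gt0 => /(_ z0).
  exact: leq_trans.
(* Elements of one residue class are determined by their quotient by [p]. *)
have le : (count (fun x => x%:R == y) (iota 0 t) <= (t %/ p).+1)%N.
  rewrite -size_filter -(size_map (fun x => x %/ p)%N) -(size_iota 0 (t %/ p).+1).
  apply: uniq_leq_size => [|z /mapP[x]]; last first.
    rewrite mem_filter mem_iota => /andP[_ /= lt] ->.
    by rewrite -[_ :: _]/(iota 0 (t %/ p).+1) mem_iota /= add0n ltnS leq_div2r // ltnW.
  rewrite map_inj_in_uniq ?filter_uniq ?iota_uniq // => a b.
  rewrite !mem_filter => /andP[/eqP aE _] /andP[/eqP bE _] eq.
  rewrite (divn_eq a p) (divn_eq b p) eq; congr (_ + _)%N.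
  by rewrite -!(val_Fp_nat pp) aE bE.
rewrite (leq_trans (leq_mul (leqnn m) le)) // mulnS mul2n -addnn leq_add //.
by rewrite (leq_trans (leq_mul mp (leqnn _))) // mulnC leq_trunc_div.
Qed.

(** Linear factors are split off one root at a time; by separation each root is hit by at most
    [2 * t / m] integers. *)
Lemma count_root (K : idomainType) m t (q : {poly K}) : separated K m -> (m <= t)%N ->
  q != 0 -> (m * count (fun x => root q x%:R) (iota 0 t) <= size q * (2 * t))%N.
Proof.
move=> [_ sep] mt; have [k] := ubnP (size q); elim: k q => // k IH q lek q0.
have [/hasP[x _ /factor_theorem[q1 qE]]|no] :=
    boolP (has (fun x => root q x%:R) (iota 0 t)); last first.
  by rewrite (@eq_in_count _ _ pred0) ?count_pred0 ?muln0 // => x xt;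
     apply: contraNF no => rx; apply/hasP; exists x.
have q10 : q1 != 0 by apply: contraNneq q0 => E; rewrite qE E mul0r.
have sE : size q = (size q1).+1.
  by rewrite qE size_mul // ?polyXsubC_eq0 // size_XsubC addn2.
have := IH q1; rewrite -ltnS -sE => /(_ lek q10) le1.
apply: (@leq_trans (m * (count (fun z => root q1 z%:R) (iota 0 t) +
                         count (fun z => z%:R == x%:R :> K) (iota 0 t)))).
  rewrite leq_mul2l; apply/orP; right; rewrite -count_predUI.
  rewrite (leq_trans _ (leq_addr _ _)) // sub_count // => z /=.
  by rewrite qE rootM root_XsubC.
by rewrite mulnDr sE mulSn addnC leq_add // sep.
Qed.

Definition zval n (X : seq nat) (f : zpoly n) : int := zeval n [seq x%:Z | x <- X] f.

Lemma zvalS n x X (f : {poly zpoly n}) :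
  zval (n := n.+1) (x :: X) f = (map_poly (zeval n [seq x%:Z | x <- X]) f).[x%:Z].
Proof. by []. Qed.

Definition zred (K : comNzRingType) n (X : seq nat) (f : {poly zpoly n}) : {poly K} :=
  map_poly intr (map_poly (zeval n [seq x%:Z | x <- X]) f).

Lemma coef_zred (K : comNzRingType) n X (f : {poly zpoly n}) i :
  (zred K X f)`_i = (zval X f`_i)%:~R.
Proof. by rewrite !coef_map. Qed.

Lemma size_zred (K : comNzRingType) n X (f : {poly zpoly n}) :
  (size (zred K X f) <= size f)%N.
Proof. by apply/leq_sizeP => j le; rewrite coef_zred nth_default // /zval rmorph0. Qed.

Lemma zval_zred (K : comNzRingType) n x X (f : {poly zpoly n}) :
  (zval (n := n.+1) (x :: X) f)%:~R = (zred K X f).[x%:R].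
Proof. by rewrite zvalS -[x%:R]/(x%:Z%:~R) horner_map. Qed.

(** A Schwartz-Zippel bound. Over the [X] that kill the leading coefficient, counted by induction,
    the whole fibre is allowed; over the others few roots remain. The constant depends on [h] alone,
    so it serves [int] and all ['F_p] at once. *)
Lemma count_zeros n (h : zpoly n) : h != 0 -> exists c : nat,
  forall K m, separated K m -> forall T, size T = n -> all (leq m) T ->
  (m * count (fun X => (zval X h)%:~R == 0 :> K)%R (box T) <= c * \prod_(t <- T) t)%N.
Proof.
elim: n h => [|n IH] h h0.
  (* Without variables, the nonzero integer [h] vanishes in [K] only if [m <= absz h]. *)
  exists (absz (h : int)) => K m [sep _] [] // _ _; rewrite big_nil /= addn0 muln1.
  case: eqP => [E|_]; rewrite ?muln0 // muln1 sep //.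
  by rewrite -[RHS]E /zval /= intz.
pose f := h : {poly zpoly n}.
have [|c cP] := IH (lead_coef f); first by rewrite lead_coef_eq0.
exists (c + 2 * size f)%N => K m sep [//|t T] [sT] /andP[mt mT].
rewrite count_box big_cons.
apply: (@leq_trans (\sum_(X <- box T)
   (m * (((zval X (lead_coef f))%:~R == 0 :> K)%R * t) + size f * (2 * t)))%N).
  rewrite big_distrr /= leq_sum // => X _.
  have [_|l0] := eqVneq ((zval X (lead_coef f))%:~R : K) 0.
    by rewrite mul1n (leq_trans _ (leq_addr _ _)) // leq_mul2l -{2}(size_iota 0 t) count_size orbT.
  rewrite mul0n muln0 add0n (eq_count (a2 := fun x => root (zred K X f) x%:R)); last first.
    by move=> x /=; rewrite zval_zred.
  apply: leq_trans (count_root sep mt _) _.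
    by apply: contraNneq l0 => E; rewrite -coef_zred E coef0.
  by rewrite leq_mul2r size_zred orbT.
rewrite big_split /= big_const_seq count_predT iter_addn_0 size_box -big_distrr -big_distrl /=.
rewrite sum_nat_of_bool mulnDl leq_add //.
  by rewrite mulnA (mulnC t) [X in (_ <= X)%N]mulnA leq_mul2r cP ?orbT.
by rewrite !mulnA (mulnC (size f)).
Qed.

(** Polynomial growth in logarithmic form; a nonzero value therefore has only [O(L)] prime
    divisors. *)
Lemma zval_bound n (h : zpoly n) : exists c : nat, forall L X, (0 < L)%N ->
  all (fun x => x < 2 ^ L)%N X -> size X = n -> (absz (zval X h) < 2 ^ (c * L))%N.
Proof.
elim: n h => [|n IH] h.
  exists (absz (h : int)) => L [] // L0 _ _; rewrite /zval /= intz.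
  by rewrite (leq_trans (ltn_expl _ (leqnn 2))) // leq_exp2l // leq_pmulr.
elim/poly_ind: (h : {poly zpoly n}) => [|f a [c cP]].
  by exists 0%N => L X L0 _ _; rewrite /zval rmorph0 expn_gt0.
have [b bP] := IH a; exists (c + b + 2)%N => L [//|x X] L0 xX [sX].
have := cP L (x :: X) L0 xX; rewrite /= sX => /(_ erefl) lt1.
have /andP[ltx XL] := xX.
have lt2 := bP L X L0 XL sX.
have -> : zval (n := n.+1) (x :: X) (f * 'X + a%:P) = zval (n := n.+1) (x :: X) f * x%:Z + zval X a.
  by rewrite !zvalS rmorphD rmorphM /= map_polyX map_polyC hornerD hornerM hornerX hornerC.
set u := zval _ _ in lt1 *; set v := zval _ _ in lt2 *.
apply: (@leq_ltn_trans (absz u * x + absz v)); 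
  have abszD (y z : int) : (absz (y + z)%R <= absz y + absz z)%N by lia.
  by apply: leq_trans (abszD _ _) _; rewrite abszM absz_nat.
have le1 : (absz u * x <= 2 ^ (c * L) * 2 ^ L)%N by rewrite leq_mul // ltnW.
have le2 : (2 ^ (c * L) * 2 ^ L <= 2 ^ ((c + b) * L + L))%N.
  by rewrite -expnD leq_exp2l // leq_add2r leq_mul2r leq_addr orbT.
have le3 : (2 ^ (b * L) <= 2 ^ ((c + b) * L + L))%N.
  by rewrite leq_exp2l // (leq_trans _ (leq_addr _ _)) // leq_mul2r leq_addl orbT.
apply: (@leq_trans (2 ^ ((c + b) * L + L).+1)); last by rewrite leq_exp2l //; nia.
rewrite expnS mul2n -addnn -addnS leq_add //; first exact: leq_trans le2.
exact: leq_trans le3.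
Qed.

Lemma prod_primes_dvd (s : seq nat) m : uniq s -> all prime s -> all (dvdn^~ m) s ->
  (\prod_(p <- s) p %| m)%N.
Proof.
elim: s => [|p s IH]; first by rewrite big_nil dvd1n.
move=> /= /andP[ps us] /andP[pp sp] /andP[pm sm]; rewrite big_cons.
rewrite Gauss_dvd ?pm ?IH //.
rewrite big_seq; elim/big_rec: _ => [|q m' qs]; first exact: coprimen1.
rewrite coprimeMr => ->; rewrite andbT prime_coprime // dvdn_prime2 //.
  by apply: contraNneq ps => ->.
exact: (allP sp).
Qed.

Lemma size_primes_le m k : (0 < m)%N -> (m < 2 ^ k)%N -> (size (primes m) <= k)%N.
Proof.
move=> m0 mk; rewrite -(leq_exp2l _ _ (leqnn 2)); apply: leq_trans (ltnW mk).
have dvdm : (\prod_(p <- primes m) p %| m)%N.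
  by apply: prod_primes_dvd; rewrite ?primes_uniq //; apply/allP => p;
     rewrite mem_primes => /and3P[].
apply: leq_trans (dvdn_leq m0 dvdm).
have : all (leq 2) (primes m).
  by apply/allP => p; rewrite mem_primes => /and3P[/prime_gt1].
elim: (primes m) => [|p s IH] /=; first by rewrite big_nil.
by move=> /andP[p2 /IH le]; rewrite expnS big_cons leq_mul.
Qed.

Definition has_large_prime (Q : pred nat) n (F : seq (zpoly n)) (X : seq nat) : bool :=
  `[< exists p, [/\ prime p, Q p & all (fun f => (p%:Z %| zval X f)%Z) F] >].

Lemma zval_in_ideal n (F : seq (zpoly n.+1)) (h : zpoly n) x X (p : int) :
  in_ideal (fun f : {poly zpoly n} => f \in F) h%:P ->
  all (fun f => (p %| zval (x :: X) f)%Z) F -> (p %| zval X h)%Z.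
Proof.
move=> Ih /allP pF.
have -> : zval X h = zval (n := n.+1) (x :: X) h%:P.
  by rewrite zvalS map_polyC hornerC.
apply: (Ih (fun f => p %| zval (n := n.+1) (x :: X) f)%Z) => [|f g|f g|f] //.
- by rewrite /zval rmorph0 dvdz0.
- by rewrite /zval rmorphD => ? ?; apply: rpredD.
- by rewrite /zval rmorphM => ?; apply: dvdz_mull.
- exact: pF.
Qed.

(** Some coefficient of some [f] in [F] survives modulo [p] at [X], so the first coordinate is a
    root of a nonzero polynomial over ['F_p] of bounded size. *)
Lemma count_fiber n (F : seq (zpoly n.+1)) (D p m t : nat) X :
  prime p -> (m <= p)%N -> (m <= t)%N ->
  (forall f, f \in F -> (size (f : {poly zpoly n}) <= D)%N) ->
  ~~ all (fun f => (p%:Z %| zval X f)%Z) (zcoefs F) ->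
  (m * count (fun x => all (fun f => (p%:Z %| zval (x :: X) f)%Z) F) (iota 0 t)
     <= D * (2 * t))%N.
Proof.
move=> pp mp mt FD /allPn[a /flattenP[/= s /mapP[/= f Ff ->] fa] pa].
have dvdE z : (p%:Z %| z)%Z = (z%:~R == 0 :> 'F_p) := dvdz_pcharf (pchar_Fp pp) z.
have q0 : zred 'F_p X f != 0.
  apply: contraNneq pa => E; rewrite dvdE.
  by have /(nthP 0)[i _ <-] := fa; rewrite -coef_zred E coef0.
apply: leq_trans (leq_trans (count_root (separated_Fp pp mp) mt q0) _).
  rewrite leq_mul2l sub_count ?orbT // => x /allP/(_ f Ff).
  by rewrite dvdE zval_zred.
by rewrite leq_mul2r (leq_trans (size_zred _ _ _)) ?FD ?orbT.
Qed.

Definition primes_upto (Q : pred nat) (m : nat) :=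
  [seq p <- iota 0 m.+1 | prime p && Q p].

Lemma mem_primes_upto Q m p : (p \in primes_upto Q m) = [&& prime p, Q p & (p <= m)%N].
Proof. by rewrite mem_filter mem_iota /= add0n ltnS andbA. Qed.

Definition prime_sum (R : realFieldType) (Q : pred nat) (m : nat) : R :=
  \sum_(p <- primes_upto Q m) p%:R ^- 2.

Lemma prime_sum_ge0 (R : realFieldType) Q m : 0 <= prime_sum R Q m.
Proof. by apply: sumr_ge0 => p _; rewrite invr_ge0 exprn_ge0. Qed.

Lemma ler_natdiv (R : realFieldType) (m a b : nat) : (0 < m)%N -> (m * a <= b)%N ->
  a%:R <= b%:R / m%:R :> R.
Proof. by move=> m0 le; rewrite ler_pdivlMr ?ltr0n // -natrM ler_nat mulnC. Qed.

Section Fiber.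
Variables (R : realFieldType) (n : nat) (F : seq (zpoly n.+1)) (h : zpoly n) (D c : nat).
Hypothesis Ih : in_ideal (fun f : {poly zpoly n} => f \in F) h%:P.
Hypothesis FD : forall f, f \in F -> (size (f : {poly zpoly n}) <= D)%N.
Hypothesis hc : forall L X, (0 < L)%N ->
  all (fun x => x < 2 ^ L)%N X -> size X = n -> (absz (zval X h) < 2 ^ (c * L))%N.

(** The four terms: one prime divides all of [zcoefs F] at [X], and the fibre is counted in full;
    primes up to [m] dividing [h] at [X]; [h] vanishing at [X]; primes above [m], which divide a
    nonzero value of [h] and so number at most [c * L]. *)
Lemma count_has_large_prime Q (m L t : nat) X :
  (0 < m)%N -> (0 < L)%N -> (m <= t)%N -> all (fun x => x < 2 ^ L)%N X -> size X = n ->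
  (count (fun x => has_large_prime Q F (x :: X)) (iota 0 t))%:R
    <= t%:R * (has_large_prime Q (zcoefs F) X)%:R
     + \sum_(p <- primes_upto Q m) (((p%:Z %| zval X h)%Z)%:R * ((D * (2 * t))%N%:R / p%:R))
     + t%:R * (zval X h == 0)%:R + (c * L * (D * (2 * t)))%N%:R / m%:R :> R.
Proof.
move=> m0 L0 mt XL sX.
set ct := count _ _; have ctt : ct%:R <= t%:R :> R.
  by rewrite ler_nat /ct -{2}(size_iota 0 t) count_size.
set S1 := \sum_(p <- _) _; have S1_ge0 : 0 <= S1.
  by apply: sumr_ge0 => p _; rewrite mulr_ge0 // divr_ge0.
set E := _ / m%:R; have E_ge0 : 0 <= E by rewrite divr_ge0.
have [A|nA] := boolP (has_large_prime Q _ X).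
  rewrite mulr1 -!addrA (le_trans ctt) // lerDl !addr_ge0 // mulr_ge0 //.
have [hX|hX] := eqVneq (zval X h) 0.
  by rewrite mulr0 add0r mulr1 -addrA addrCA (le_trans ctt) // lerDl addr_ge0.
rewrite !mulr0 add0r addr0.
have notA p : prime p -> Q p -> ~~ all (fun f => (p%:Z %| zval X f)%Z) (zcoefs F).
  by move=> pp Qp; apply: contra nA => pF; apply/asboolP; exists p.
pose cr p := count (fun x => all (fun f => (p%:Z %| zval (x :: X) f)%Z) F) (iota 0 t).
pose ps1 := [seq p <- primes_upto Q m | (p%:Z %| zval X h)%Z].
pose ps2 := [seq p <- primes (absz (zval X h)) | (m < p)%N && Q p].
have le : (ct <= \sum_(p <- ps1 ++ ps2) cr p)%N.
  apply: count_cover => x /asboolP[p [pp Qp pF]]; apply/hasP; exists p => //.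
  have ph := zval_in_ideal Ih pF.
  rewrite mem_cat !mem_filter ph mem_iota pp Qp /= add0n ltnS !andbT mem_primes.
  by case: ltnP => //= _; rewrite pp absz_gt0 hX.
apply: (@le_trans _ _ (\sum_(p <- ps1 ++ ps2) cr p)%N%:R); first by rewrite ler_nat.
rewrite big_cat natrD lerD //=.
  rewrite natr_sum /ps1 big_filter /S1 big_mkcond /= big_seq [leRHS]big_seq.
  apply: ler_sum => p; rewrite mem_primes_upto => /and3P[pp Qp pm].
  case: ifP => _; last by rewrite mul0r.
  rewrite mul1r; apply: ler_natdiv; first exact: prime_gt0.
  by apply: count_fiber => //; [apply: leq_trans mt | apply: notA].
rewrite /E natrM -mulrA.
apply: (@le_trans _ _ (\sum_(p <- ps2) ((D * (2 * t))%N%:R / m%:R))).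
  rewrite natr_sum big_seq [leRHS]big_seq; apply: ler_sum => p.
  rewrite mem_filter mem_primes => /andP[/andP[mp Qp] /and3P[pp _ _]].
  by apply: ler_natdiv => //; apply: count_fiber => //; [apply: ltnW | apply: notA].
rewrite big_const_seq count_predT iter_addr_0 -[leLHS]mulr_natl.
rewrite ler_wpM2r ?divr_ge0 // ler_nat size_filter (leq_trans (count_size _ _)) //.
by rewrite size_primes_le ?absz_gt0 // hc.
Qed.
End Fiber.

Theorem box_sieve (R : realFieldType) n (F : seq (zpoly n)) :
  has (predC1 0) F -> zcoprime F -> exists c : nat, forall Q m L T,
  (0 < m)%N -> (0 < L)%N -> size T = n -> all (fun t => m <= t <= 2 ^ L)%N T ->
  (count (has_large_prime Q F) (box T))%:R
    <= c%:R * (\prod_(t <- T) t)%N%:R * (prime_sum R Q m + L%:R / m%:R) :> R.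
Proof.
elim: n F => [|n IH] F F0 Fc.
  have /hasP[/= a Fa a0] := F0.
  (* A bad prime divides the nonzero integer [a]. If it is at most [m], its term in [prime_sum]
     times [a ^ 2] is at least 1; otherwise [m <= |a|] and [a ^ 2 * L / m] is at least 1. *)
  exists (absz (a : int) ^ 2)%N => Q m L [] // m0 L0 _ _; rewrite big_nil mulr1 /= addn0.
  have [/asboolP[p [pp Qp /allP/(_ a Fa)]]|_] := boolP (has_large_prime _ _ _); last first.
    by rewrite mulr_ge0 // addr_ge0 ?prime_sum_ge0 // divr_ge0.
  rewrite /zval /= intz => pa.
  have pa' : (p <= absz (a : int))%N.
    by have := dvdn_leq _ pa; rewrite absz_gt0 /= => /(_ a0).
  have a1 : (0 < absz (a : int))%N by rewrite absz_gt0.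
  have [pm|mp] := leqP p m.
    have le : p%:R ^- 2 <= prime_sum R Q m.
      rewrite /prime_sum (big_rem p) /= ?mem_primes_upto ?pp ?Qp // lerDl.
      by apply: sumr_ge0 => q _; rewrite invr_ge0 exprn_ge0.
    apply: (@le_trans _ _ ((absz (a : int) ^ 2)%N%:R * p%:R ^- 2)); last first.
      by rewrite ler_wpM2l // (le_trans le) // lerDl divr_ge0.
    rewrite ler_pdivlMr ?exprn_gt0 ?ltr0n ?prime_gt0 // mul1r -natrX ler_nat.
    by rewrite leq_sqr.
  apply: (@le_trans _ _ ((absz (a : int) ^ 2)%N%:R * (L%:R / m%:R))); last first.
    by rewrite ler_wpM2l // lerDr prime_sum_ge0.
  rewrite mulrA ler_pdivlMr ?ltr0n // mul1r -natrM ler_nat.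
  have am : (m <= absz (a : int))%N by apply: leq_trans pa'; apply: ltnW.
  by apply: leq_trans am _; rewrite -mulnn -mulnA leq_pmulr // muln_gt0 a1.
have [h h0 Ih] := elimination F0 Fc.
have [cA IHA] := IH _ (zcoefs_neq0 F0) (zcoprime_coefs Fc).
have [ch chP] := count_zeros h0.
have [c cP] := zval_bound h.
pose D := (\sum_(f <- F) size (f : {poly zpoly n}))%N.
have FD (f : zpoly n.+1) : f \in F -> (size (f : {poly zpoly n}) <= D)%N.
  by move=> Ff; rewrite /D (big_rem f) //= leq_addr.
(* One summand for each of the four terms of the fibre estimate. *)
exists (cA + 2 * D * ch + ch + 2 * D * c)%N => Q m L [|t T] // m0 L0 [sT] /andP[/andP[mt tL] mT].
have mT' : all (leq m) T by apply: sub_all mT => x /andP[].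
have boxL X : X \in box T -> all (fun x => x < 2 ^ L)%N X /\ size X = n.
  move=> XT; split; last by rewrite (size_in_box XT).
  elim: (T) mT X XT => [|u U IHU] /=; first by move=> _ X; rewrite inE => /eqP ->.
  move=> /andP[/andP[_ uL] UL] X /allpairsP[[Y x] /= [YU xu ->]] /=.
  by rewrite IHU // andbT (leq_trans _ uL) //; move: xu; rewrite mem_iota.
have := IHA Q m L T m0 L0 sT mT.
set cntA := count _ (box T); set V := (\prod_(u <- T) u)%N; set S := prime_sum R Q m => leA.
have S0 : 0 <= S by apply: prime_sum_ge0.
have -> : (\prod_(j <- t :: T) j = t * V)%N by rewrite big_cons.
(* Separation at scale [p] saves a factor [p] over the base; with the factor [p] saved in the fibre
   this makes [p ^ -2]. *)
have zeros_dvd p : prime p -> (p <= m)%N ->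
    (count (fun X => (p%:Z %| zval X h)%Z) (box T))%:R <= (ch * V)%N%:R / p%:R :> R.
  move=> pp pm; apply: ler_natdiv; first exact: prime_gt0.
  rewrite (eq_count (a2 := fun X => (zval X h)%:~R == 0 :> 'F_p)).
    apply: chP => //; first exact: separated_Fp.
    by apply: sub_all mT' => x; apply: leq_trans.
  by move=> X; rewrite (dvdz_pcharf (pchar_Fp pp)).
have zeros : (count (fun X => zval X h == 0) (box T))%:R <= (ch * V)%N%:R / m%:R :> R.
  apply: ler_natdiv => //; rewrite (eq_count (a2 := fun X => (zval X h)%:~R == 0 :> int)).
    exact: chP (separated_int m) _ sT mT'.
  by move=> X; rewrite intz.
rewrite count_box natr_sum.
apply: (@le_trans _ _ (\sum_(X <- box T) (
   t%:R * (has_large_prime Q (zcoefs F) X)%:R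
     + \sum_(p <- primes_upto Q m) (((p%:Z %| zval X h)%Z)%:R * ((D * (2 * t))%N%:R / p%:R))
     + t%:R * (zval X h == 0)%:R + (c * L * (D * (2 * t)))%N%:R / m%:R))).
  rewrite big_seq [leRHS]big_seq; apply: ler_sum => X /boxL[XL sX].
  exact: count_has_large_prime.
rewrite !big_split /= -!mulr_sumr exchange_big /=.
rewrite big_const_seq count_predT iter_addr_0 size_box -/V.
rewrite -!natr_sum !sum_nat_of_bool -/cntA.
have leD : \sum_(p <- primes_upto Q m) \sum_(X <- box T)
    (((p%:Z %| zval X h)%Z)%:R * ((D * (2 * t))%N%:R / p%:R))
    <= (2 * D * ch * (t * V))%N%:R * S.
  rewrite /S /prime_sum mulr_sumr big_seq [leRHS]big_seq; apply: ler_sum => p.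
  rewrite mem_primes_upto => /and3P[pp _ pm].
  rewrite -mulr_suml -natr_sum sum_nat_of_bool.
  apply: le_trans (ler_wpM2r _ (zeros_dvd p pp pm)) _; first by rewrite divr_ge0.
  rewrite le_eqVlt; apply/orP; left; apply/eqP.
  rewrite !natrM; field; rewrite pnatr_eq0 -lt0n prime_gt0 //.
have t0 : 0 <= t%:R :> R by [].
have le1 := ler_wpM2l t0 leA; have le2 := ler_wpM2l t0 zeros.
apply: le_trans (lerD (lerD (lerD le1 leD) le2) (lexx _)) _.
rewrite -[_ *+ V]mulr_natr !natrD !natrM.
have mi : 0 < (m%:R : R)^-1 by rewrite invr_gt0 ltr0n.
have L1 : 1 <= L%:R :> R by rewrite ler1n.
set w : R := m%:R^-1 in mi *.
have p1 : 0 <= t%:R * V%:R * S by rewrite !mulr_ge0.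
have p2 : 0 <= t%:R * V%:R * w by rewrite !mulr_ge0 // ltW.
have p3 : t%:R * V%:R * w <= t%:R * V%:R * w * L%:R by rewrite ler_peMr.
have : ch%:R * (t%:R * V%:R * w) <= ch%:R * (t%:R * V%:R * w * L%:R) by rewrite ler_wpM2l.
have q1 : 0 <= D%:R * ch%:R * (t%:R * V%:R * w * L%:R) by rewrite !mulr_ge0 // ltW.
have q2 : 0 <= D%:R * c%:R * (t%:R * V%:R * S) by rewrite !mulr_ge0.
have q3 : 0 <= ch%:R * (t%:R * V%:R * S) by rewrite !mulr_ge0.
rewrite /=; lra.
Qed.

(** * Sums over large primes *)

Lemma bin_le_exp2 a b : ('C(a, b) <= 2 ^ a)%N.
Proof.
have [lt|le] := ltnP a b; first by rewrite bin_small.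
have lt : (b < a.+1)%N by [].
rewrite -[2%N]/(1 + 1)%N expnDn (bigD1 (Ordinal lt)) //=.
by rewrite !exp1n !muln1 leq_addr.
Qed.

(** Chebyshev's argument: the primes between [n = 2 ^ l] and [2 * n] all divide the central binomial
    coefficient, which is at most [2 ^ (2 * n)]. *)
Lemma count_primes_dyadic l : (0 < l)%N ->
  (l * count prime (iota (2 ^ l) (2 ^ l)) <= 2 ^ l.+1)%N.
Proof.
(* The case [l = 1] is separate because there [n = 2] is itself prime. *)
case: l => [//|[|k] _]; first by rewrite mul1n (leq_trans (count_size _ _)) // size_iota.
set l := k.+2; set n := (2 ^ l)%N; set ps := [seq p <- iota n n | prime p].
have n0 : (0 < n)%N by rewrite expn_gt0.
rewrite -size_filter -/ps -(leq_exp2l _ _ (leqnn 2)) expnM -/n.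
have psP p : p \in ps -> [/\ prime p, (n < p)%N & (p < 2 * n)%N].
  rewrite mem_filter mem_iota => /and3P[pp np pn]; split=> //; last by rewrite mul2n -addnn.
  rewrite ltn_neqAle np andbT; apply: contraTneq pp => <-.
  by rewrite /n /l expnS; apply/primePn; right; exists 2%N; rewrite ?dvdn_mulr //= ltn_Pmulr // (ltn_exp2l 0).
have dvd : (\prod_(p <- ps) p %| 'C(2 * n, n))%N.
  apply: prod_primes_dvd; first by rewrite filter_uniq ?iota_uniq.
    by apply/allP => p /psP[].
  apply/allP => p /psP[pp np pn] /=.
  have : (p %| (2 * n)`!)%N by apply: dvdn_fact; rewrite prime_gt0 //= ltnW.
  rewrite -(@bin_fact (2 * n) n) ?leq_pmull // mul2n -addnn addnK.
  have pn' j : (j < p)%N -> (p %| j`!)%N = false.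
    elim: j => [|j IH] jp; first by rewrite dvdn1 gtn_eqF ?prime_gt1.
    by rewrite factS Euclid_dvdM // gtnNdvd //= IH // ltnW.
  by rewrite !Euclid_dvdM // pn' // !orbF.
have le1 : (n ^ size ps <= \prod_(p <- ps) p)%N.
  rewrite big_seq; have : {subset ps <= ps} by [].
  elim: {1 3 4}ps => [|p s IH] sub; first by rewrite big_nil.
  rewrite big_cons sub ?mem_head // expnS leq_mul //.
    by have /psP[_ /ltnW] := sub p (mem_head _ _).
  by apply: IH => q qs; apply: sub; rewrite inE qs orbT.
apply: leq_trans le1 _; apply: leq_trans (dvdn_leq _ dvd) _.
  by rewrite bin_gt0 leq_pmull.
by rewrite expnS; apply: bin_le_exp2.
Qed.

(** The block from [2 ^ K] to [2 ^ K.+1] contributes at most [2 / (K * 2 ^ K)], which is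
    [4 / K * (2 ^- K - 2 ^- K.+1)]; as [K >= i], the blocks telescope. *)
Lemma sum_primes_dyadic (R : realFieldType) i K : (0 < i)%N -> (i <= K)%N ->
  \sum_(p <- iota 0 (2 ^ K) | prime p && (2 ^ i <= p)%N) p%:R ^- 2
    <= 4 / i%:R * (2 ^- i - 2 ^- K) :> R.
Proof.
move=> i0; elim: K => [|K IH].
  by rewrite leqn0 => /eqP iE; rewrite iE in i0.
rewrite leq_eqVlt => /predU1P[iE|]; last first.
  rewrite ltnS => iK.
  rewrite expnS mul2n -addnn iotaD add0n big_cat /=.
  have le : \sum_(p <- iota (2 ^ K) (2 ^ K) | prime p && (2 ^ i <= p)%N) p%:R ^- 2
     <= 4 / i%:R * (2 ^- K - 2 ^- K.+1) :> R.
    apply: (@le_trans _ _ ((count prime (iota (2 ^ K) (2 ^ K)))%:R * (2 ^- K) ^+ 2)).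
      rewrite -sum_nat_of_bool natr_sum mulr_suml big_mkcond /= big_seq [leRHS]big_seq.
      apply: ler_sum => p; rewrite mem_iota => /andP[Kp _].
      have pp2 : p%:R ^- 2 <= (2 ^- K) ^+ 2 :> R.
        rewrite -exprVn lerXn2r ?nnegrE ?invr_ge0 ?exprn_ge0 //.
        rewrite lef_pV2 ?posrE ?exprn_gt0 // -?natrX ?ler_nat ?ltr0n //.
        by rewrite (leq_trans _ Kp) // expn_gt0.
      case: (prime p) => /=; rewrite ?mul0r // mul1r; case: ifP => // _.
      by rewrite sqr_ge0.
    have K0 : (0 < K)%N := leq_trans i0 iK.
    have := count_primes_dyadic K0; rewrite -(ler_nat R) natrM natrX => le1.
    set c : R := (count _ _)%:R in le1 *.
    set u : R := 2 ^- K; have u0 : 0 < u by rewrite invr_gt0 exprn_gt0.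
    have uE : 2 ^+ K = u^-1 by rewrite /u invrK.
    have u1E : 2 ^- K.+1 = u / 2 by rewrite exprS invfM mulrC.
    have iR : 0 < i%:R :> R by rewrite ltr0n.
    rewrite exprS uE in le1; rewrite u1E.
    have c0 : 0 <= c by [].
    have le2 : i%:R * c <= 2 / u by apply: le_trans le1; rewrite ler_wpM2r // ler_nat.
    have -> : 4 / i%:R * (u - u / 2) = 2 * u / i%:R by field; rewrite lt0r_neq0.
    rewrite ler_pdivlMr //.
    have -> : c * u ^+ 2 * i%:R = (i%:R * c) * u ^+ 2 by ring.
    apply: le_trans (ler_wpM2r _ le2) _; first by rewrite exprn_ge0 // ltW.
    by rewrite le_eqVlt; apply/orP; left; apply/eqP; field; rewrite lt0r_neq0.
  apply: le_trans (lerD (IH iK) le) _.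
  by rewrite -mulrDr addrA subrK.
rewrite -iE subrr mulr0 big_seq_cond big_pred0 // => p; apply/negbTE.
by rewrite mem_iota add0n ltnNge; case: (2 ^ i <= p)%N; rewrite ?andbF.
Qed.

Lemma ln2_bounds (R : realType) : 2^-1 <= ln 2 :> R /\ ln 2 <= 1 :> R.
Proof.
split.
  have := @le_ln1Dx R (- 2^-1); rewrite (_ : 1 - 2^-1 = 2^-1); last by lra.
  by rewrite lnV ?posrE // => /(_ _); lra.
by have := @le_ln1Dx R 1; rewrite (_ : 1 + 1 = 2) //; apply; lra.
Qed.

Lemma prime_sum_tail (R : realType) (N : R) m : 2 <= N ->
  prime_sum R (fun p => N <= p%:R) m <= 16 / (N * ln N).
Proof.
move=> N2; have N0 : 0 <= N by lra.
have /andP[kN Nk] := truncn_itv N0; set k := Num.truncn N in kN Nk.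
have k2 : (2 <= k)%N by rewrite /k truncn_ge_nat.
set i := trunc_log 2 k.
have i0 : (0 < i)%N by rewrite trunc_log_gt0 k2.
have /andP[ik ki] : (2 ^ i <= k < 2 ^ i.+1)%N by apply: trunc_log_bounds; rewrite // ltnW.
apply: (@le_trans _ _ (4 / i%:R * (2 ^- i))).
  apply: (@le_trans _ _ (4 / i%:R * (2 ^- i - 2 ^- (i + m.+1)))); last first.
    by rewrite ler_wpM2l ?divr_ge0 // gerBl invr_ge0 exprn_ge0.
  apply: le_trans (sum_primes_dyadic _ i0 (leq_addr _ _)).
  have mK : (m.+1 <= 2 ^ (i + m.+1))%N.
    by rewrite (leq_trans (ltnW (ltn_expl m.+1 (leqnn 2)))) // leq_exp2l // leq_addl.
  rewrite -(subnKC mK) iotaD big_cat /= /prime_sum big_filter add0n.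
  rewrite -[leLHS]addr0 lerD //; last first.
    by apply: sumr_ge0 => p _; rewrite invr_ge0 exprn_ge0.
  rewrite big_mkcond [leRHS]big_mkcond; apply: ler_sum => p _.
  case: (prime p) => //=; case: ifP => [Np|_].
    have -> // : (2 ^ i <= p)%N.
    by rewrite (leq_trans ik) // -ltnS -(ltr_nat R) (le_lt_trans kN) // (le_lt_trans Np) // ltr_nat.
  by case: ifP => // _; rewrite invr_ge0 exprn_ge0.
have lnN : 0 < ln N by rewrite ln_gt0 //; lra.
have N2i : N <= 2 ^+ i.+1.
  by apply: (ltW (lt_le_trans Nk _)); rewrite -natrX ler_nat.
have [_ ln2] := ln2_bounds R.
have lni : ln N <= i.+1%:R.
  apply: (@le_trans _ _ (ln (2 ^+ i.+1))).
    by rewrite ler_ln ?posrE ?exprn_gt0 //; lra.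
  by rewrite lnXn // -[leLHS]mulr_natr ler_piMl.
have iR : 1 <= i%:R :> R by rewrite ler1n.
rewrite ler_pdivlMr ?mulr_gt0 //; last by lra.
set u : R := 2 ^+ i; have u0 : 0 < u by rewrite exprn_gt0.
have i0R : 0 < i%:R :> R by rewrite ltr0n.
(* [N <= 2 ^ i.+1] and [ln N <= i + 1 <= 2 * i] cost two factors 2, which turn the 4 of the dyadic
   sum into 16. *)
have le3 : N * ln N <= 4 * i%:R * u.
  apply: (@le_trans _ _ (2 ^+ i.+1 * i.+1%:R)); first by rewrite ler_pM // ltW.
  rewrite exprS -/u -natr1; nra.
apply: le_trans (ler_wpM2l _ le3) _; first by rewrite mulr_ge0 ?divr_ge0 // invr_ge0 ltW.
by rewrite le_eqVlt; apply/orP; left; apply/eqP; field; rewrite !lt0r_neq0.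
Qed.

(** * Dyadic volume of the height region *)

Section Pairing.
Variable d : nat.
Implicit Types m v w : 'I_d -> int.

Lemma pairing_sumr (I : Type) (s : seq I) (P : pred I) m (c : I -> int) (V : I -> 'I_d -> int) v :
  (forall i, v i = \sum_(k <- s | P k) c k * V k i) ->
  pairing m v = \sum_(k <- s | P k) c k * pairing m (V k).
Proof.
move=> vE; rewrite /pairing; under eq_bigr do rewrite vE mulr_sumr.
rewrite exchange_big /=; apply: eq_bigr => k _; rewrite mulr_sumr.
by apply: eq_bigr => i _; rewrite mulrCA.
Qed.

End Pairing.

(** * Dual bases of regular cones and the height exponent *)

Section DualBasis.
Variables (n d : nat) (nv : 'I_n -> 'I_d -> int).

Definition dual_basis (s : {set 'I_n}) (u : 'I_n -> 'I_d -> int) : Prop :=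
  (forall rho rho', rho \in s -> rho' \in s -> pairing (u rho) (nv rho') = (rho == rho')%:R) /\
  (forall v i, v i = \sum_(rho in s) pairing (u rho) v * nv rho i).

Lemma exists_dual_basis s : Zbasis nv s -> exists u, dual_basis s u.
Proof.
move=> [gen uniq_coef]; have [c cE] := choice (fun i => gen (fun j => (j == i)%:R)).
pose u rho i := c i rho.
have uE v i : v i = \sum_(rho in s) pairing (u rho) v * nv rho i.
  transitivity (\sum_j v j * (i == j)%:R).
    by rewrite (bigD1 i) //= eqxx mulr1 big1 ?addr0 // => j /negbTE; rewrite eq_sym => ->; rewrite mulr0.
  under eq_bigr do rewrite (cE _ i) mulr_sumr.
  rewrite exchange_big /=; apply: eq_bigr => rho _.
  by rewrite /pairing mulr_suml; apply: eq_bigr => j _; rewrite mulrA /u (mulrC (v j)).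
exists u; split=> // rho rho' rs rs'.
apply: (uniq_coef (fun rho => pairing (u rho) (nv rho')) (fun rho => (rho == rho')%:R)) => // i.
rewrite -uE (bigD1 rho') //= eqxx mul1r big1 ?addr0 // => k /andP[_ /negbTE->].
by rewrite mul0r.
Qed.

Variables (s : {set 'I_n}) (u : 'I_n -> 'I_d -> int).
Hypothesis us : dual_basis s u.

(** The sum of the dual basis vectors pairs to 1 with each ray of [s], so the default value in
    [msig] does not occur; expanding [v] in the rays of [s] gives the rest. *)
Lemma pairing_msig v : pairing (msig nv s) v = \sum_(rho in s) pairing (u rho) v.
Proof.
have [uu uE] := us.
have msigE rho : rho \in s -> pairing (msig nv s) (nv rho) = 1.
  rewrite /msig; case: pselect => [h|[]]; first exact: (svalP (cid h)).
  exists [ffun i => \sum_(rho in s) u rho i] => rho' rs.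
  transitivity (\sum_(k in s) pairing (u k) (nv rho')).
    rewrite /pairing exchange_big /=; apply: eq_bigr => i _.
    by rewrite ffunE mulr_suml.
  rewrite (bigD1 rho') //= uu // eqxx big1 ?addr0 // => k /andP[ks /negbTE kr].
  by rewrite uu // kr.
rewrite (pairing_sumr _ (uE v)); apply: eq_bigr => rho rs.
by rewrite msigE // mulr1.
Qed.

Lemma acoef_basis rho : rho \in s -> acoef nv s rho = 0.
Proof.
move=> rs; rewrite /acoef pairing_msig (bigD1 rho) //= us.1 // eqxx big1 ?addr0 ?subrr //.
by move=> k /andP[ks /negbTE kr]; rewrite us.1 // kr.
Qed.

(** The matrix of rays factors through the [#|s|] coordinates on the basis, and its rows indexed by
    [s] have the dual basis as right inverse; so its rank is exactly [#|s|]. *)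
Lemma rank_picE : rank_pic nv = (n - #|s|)%N.
Proof.
have [uu uE] := us; congr (n - _)%N; set A := \matrix_(_, _) _.
pose M1 : 'M[rat]_(n, #|s|) := \matrix_(i, j) (pairing (u (enum_val j)) (nv i))%:~R.
pose M2 : 'M[rat]_(#|s|, d) := \matrix_(j, i) (nv (enum_val j) i)%:~R.
pose U : 'M[rat]_(d, #|s|) := \matrix_(i, j) (u (enum_val j) i)%:~R.
pose S : 'M[rat]_(#|s|, n) := \matrix_(j, i) (enum_val j == i)%:R.
apply/eqP; rewrite eqn_leq; apply/andP; split.
  have -> : A = M1 *m M2.
    apply/matrixP => i j; rewrite !mxE (uE (nv i) j) rmorph_sum /= big_enum_val /=.
    by apply: eq_bigr => k _; rewrite !mxE rmorphM.
  exact: mulmx_max_rank.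
have M2U : M2 *m U = 1%:M.
  apply/matrixP => i j; rewrite !mxE.
  transitivity ((pairing (u (enum_val j)) (nv (enum_val i)))%:~R : rat).
    rewrite /pairing rmorph_sum; apply: eq_bigr => k _.
    by rewrite !mxE rmorphM /= mulrC.
  by rewrite uu ?enum_valP // (inj_eq enum_val_inj) eq_sym; case: eqP.
have M2E : M2 = S *m A.
  apply/matrixP => j i; rewrite !mxE (bigD1 (enum_val j)) //= big1 ?addr0.
    by rewrite !mxE eqxx mul1r.
  by move=> k /negbTE; rewrite !mxE eq_sym => ->; rewrite mul0r.
rewrite -{1}(mxrank1 rat #|s|) -M2U M2E -mulmxA.
by rewrite (leq_trans (mxrankM_maxr _ _)) // mxrankM_maxl.
Qed.

(* Coordinates on [sigma] of minus the weighted sum of the rays. *)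
Definition bcoord (k : 'I_n -> nat) (rho : 'I_n) : int :=
  - \sum_(r < n) (k r)%:Z * pairing (u rho) (nv r).

Lemma bcoord_offbasis k rho : rho \in s ->
  bcoord k rho = - (k rho)%:Z - \sum_(r | r \notin s) (k r)%:Z * pairing (u rho) (nv r).
Proof.
move=> rs; rewrite /bcoord (bigID (mem s)) /= opprD; congr (- _ - _).
rewrite (bigD1 rho) //= us.1 // eqxx mulr1 big1 ?addr0 // => r /andP[r's /negbTE rr].
by rewrite us.1 // eq_sym rr mulr0.
Qed.

(** Pairing with [msig] sums the coordinates in the basis [s]. The left side is the base-2 logarithm
    of the height monomial of [s] at the point [2 ^ k]. *)
Lemma sum_acoef k : \sum_r acoef nv s r * (k r)%:Z =
  (\sum_r k r)%N%:Z + \sum_(rho in s) bcoord k rho.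
Proof.
transitivity (\sum_r ((k r)%:Z - pairing (msig nv s) (nv r) * (k r)%:Z)).
  by apply: eq_bigr => r _; rewrite /acoef mulrBl mul1r.
rewrite sumrB; congr (_ + _); first by rewrite (big_morph Posz PoszD (erefl _)).
rewrite /bcoord sumrN; congr (- _); rewrite exchange_big /=.
apply: eq_bigr => r _; rewrite pairing_msig mulr_suml.
by apply: eq_bigr => rho _; rewrite mulrC.
Qed.

Lemma sum_acoef_offbasis k : \sum_r acoef nv s r * (k r)%:Z =
  \sum_(r | r \notin s) acoef nv s r * (k r)%:Z.
Proof.
rewrite (bigID (mem s)) /= big1 ?add0r // => r rs.
by rewrite acoef_basis // mul0r.
Qed.

End DualBasis.

(** By completeness [w] lies in a cone; its nonnegative real coordinates there are read off by the
    dual basis, hence are these integers. *)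
Lemma complete_dual (R : realType) n d (nv : 'I_n -> 'I_d -> int) Dmax (w : 'I_d -> int) :
  complete_regular_fan R nv Dmax -> exists2 s, s \in Dmax &
    forall u, dual_basis nv s u -> forall rho, rho \in s -> 0 <= pairing (u rho) w.
Proof.
move=> [_ _ _ _ comp]; have [s sD [lam [lam0 wE]]] := comp (fun i => (w i)%:~R).
exists s => // u [uu _] rho rs; rewrite -(ler0z R).
suff -> : (pairing (u rho) w)%:~R = lam rho by [].
rewrite /pairing rmorph_sum /=.
under eq_bigr do rewrite rmorphM /= wE mulr_sumr.
rewrite exchange_big /= (bigD1 rho) //= [X in _ + X]big1 ?addr0.
  transitivity (lam rho * (pairing (u rho) (nv rho))%:~R); last by rewrite uu // eqxx mulr1.
  by rewrite rmorph_sum mulr_sumr; apply: eq_bigr => i _; rewrite rmorphM /= mulrCA.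
move=> r /andP[r's /negbTE rr].
transitivity (lam r * (pairing (u rho) (nv r))%:~R); last by rewrite uu // eq_sym rr mulr0.
by rewrite rmorph_sum mulr_sumr; apply: eq_bigr => i _; rewrite rmorphM /= mulrCA.
Qed.

(** Completeness puts the opposite of the ray [rho0] in some cone; adding [nv rho0] to its expansion
    there gives the relation. Such relations later test the signs of linear forms. *)
Lemma exists_relation (R : realType) n d (nv : 'I_n -> 'I_d -> int) Dmax rho0 :
  complete_regular_fan R nv Dmax -> exists k : 'I_n -> nat,
    (0 < k rho0)%N /\ forall m, \sum_r (k r)%:Z * pairing m (nv r) = 0.
Proof.
move=> fan; have [s sD pos] := complete_dual (fun i => - nv rho0 i) fan.
have [_ _ /(_ s sD)/exists_dual_basis[u us] _ _] := fan.
exists (fun r => (r == rho0) + (r \in s) * absz (pairing (u r) (fun i => - nv rho0 i)))%N.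
rewrite eqxx; split=> // m.
under eq_bigr do rewrite PoszD mulrDl PoszM.
rewrite big_split /= (bigD1 rho0) //= eqxx mul1r [X in _ + X + _]big1 ?addr0; last first.
  by move=> r /negbTE->; rewrite mul0r.
have -> : pairing m (nv rho0) = - pairing m (fun i => - nv rho0 i).
  by rewrite /pairing -sumrN; apply: eq_bigr => i _; rewrite mulrN opprK.
rewrite (pairing_sumr _ (us.2 _)) [X in _ + X](bigID (mem s)) /= [X in _ + (_ + X)]big1.
  rewrite addr0 addrC; apply/eqP; rewrite subr_eq0; apply/eqP; apply: eq_bigr => r rs.
  by rewrite rs mul1r gez0_abs // pos.
by move=> r /negbTE->; rewrite !mul0r.
Qed.

Local Notation nt k := (fun r => nat_of_ord (fun_of_fin k r)).

(** * Weighted lattice point counts by change of variables *)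

Section WeightedCount.
Variables (n L : nat).
Local Notation point := {ffun 'I_n -> 'I_L.+1}.

Definition total (k : 'I_n -> nat) : nat := \sum_r k r.

Lemma sum_decay : (\sum_(x < L.+1) 2 ^ (L - x) <= 2 ^ L.+1)%N.
Proof.
rewrite (reindex_inj rev_ord_inj) /=.
under eq_bigr => i _ do rewrite subSS (subKn (_ : i <= L)%N) -1?ltnS //.
elim: L => [|l IH]; first by rewrite big_ord_recl big_ord0.
by rewrite big_ord_recr /= [X in (_ <= X)%N]expnS mul2n -addnn leq_add2r.
Qed.

(* [z] is a change of variables whose coordinates in [D] carry the exponential
   decay and whose coordinates in [E] are frozen. *)
Lemma weighted_count (P : pred point) (z : point -> point) (D E : {set 'I_n}) (j : nat) :
  [disjoint D & E] -> {in P &, injective z} ->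
  (forall k, P k -> (total (nt k) + \sum_(r in D) z k r <= L)%N) ->
  (forall k r, P k -> r \in E -> z k r = j :> nat) ->
  (\sum_(k | P k) 2 ^ total (nt k) <= 2 ^ L * 2 ^ #|D| * L.+1 ^ (n - #|D| - #|E|))%N.
Proof.
move=> DE zinj zD zE.
(* This factor keeps the decay in the natural numbers: [2 ^ (L - x)] replaces [2 ^ (- x)] in each
   coordinate of [D]. *)
rewrite -(leq_pmul2l (_ : 0 < 2 ^ (L * #|D|))%N) ?expn_gt0 //.
pose w r (x : 'I_L.+1) := (if r \in D then 2 ^ (L - x) else if r \in E then nat_of_bool (x == j :> nat) else 1)%N.
apply: (@leq_trans (2 ^ L * \sum_(k | P k) \prod_r w r (z k r))%N).
  rewrite !big_distrr /= leq_sum // => k Pk.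
  rewrite (bigID (mem D)) /= [X in (_ * (_ * X))%N]big1 => [|r /negbTE rD]; last first.
    by rewrite /w rD; case: ifP => // rE; rewrite (zE k) // eqxx.
  rewrite muln1 (eq_bigr (fun r => 2 ^ (L - z k r))%N) => [|r rD]; last by rewrite /w rD.
  rewrite -expn_sum -!expnD leq_exp2l //.
  have : (\sum_(r in D) (L - z k r) + \sum_(r in D) z k r = L * #|D|)%N.
    rewrite -big_split /= mulnC -sum_nat_const; apply: eq_bigr => r _.
    by rewrite subnK // -ltnS.
  have := zD k Pk; move: (total _) (\sum_(r in D) z k r)%N (\sum_(r in D) (L - z k r))%N (L * #|D|)%N.
  by move=> a b c e; lia.
rewrite mulnCA -!mulnA leq_mul2l; apply/orP; right.
apply: (@leq_trans (\sum_(f : point) \prod_r w r (f r))%N).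
  rewrite -(big_imset (fun f : point => \prod_r w r (f r))%N zinj) /=.
  rewrite [X in (_ <= X)%N](bigID (mem (z @: P))) /= leq_addr //.
rewrite -(bigA_distr_bigA (fun r x => w r x)) /=.
apply: (@leq_trans (\prod_r (if r \in D then 2 ^ L.+1 else if r \in E then 1 else L.+1))%N).
  apply: leq_prod => r _; rewrite /w; case: ifP => _; first exact: sum_decay.
  case: ifP => _; last by rewrite sum_nat_const card_ord muln1.
  have [jL|Lj] := ltnP j L.+1.
    rewrite (bigD1 (Ordinal jL)) //= eqxx big1 // => i /negbTE.
    by rewrite -val_eqE /= => ->.
  by rewrite big1 // => i _; rewrite ltn_eqF // (leq_trans _ Lj).
rewrite (bigID (mem D)) /= (eq_bigr (fun=> 2 ^ L.+1)%N) => [|r ->//].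
rewrite prod_nat_const -expnM [X in (_ * X <= _)%N](_ : _ = L.+1 ^ (n - #|D| - #|E|))%N.
  by rewrite mulnA -expnD mulSn leq_mul2r addnC leqnn orbT.
rewrite (bigID (mem E)) /= big1 ?mul1n => [|r /andP[/negbTE-> ->//]].
rewrite (eq_bigr (fun=> L.+1)) => [|r /andP[/negbTE-> /negbTE->]//].
rewrite prod_nat_const; congr (_ ^ _)%N.
rewrite -subnDA -(cardsUI D E).
have -> : D :&: E = set0 by apply/eqP; rewrite setI_eq0.
rewrite cards0 addn0 -[X in (X - _)%N]card_ord -(cardsC (D :|: E)) addKn; apply: eq_card => r.
by rewrite !inE negb_or.
Qed.
End WeightedCount.

(** The power is at most a falling factorial of [x + A], which is [A!] times a binomial coefficient.
    It lets an exponential absorb powers of [L + 1]. *)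
Lemma expn_le_exp2 x A : (x.+1 ^ A <= A`! * 2 ^ A * 2 ^ x)%N.
Proof.
apply: (@leq_trans ((x + A) ^_ A)).
  elim: A => [|A IH]; first by rewrite ffactn0.
  by rewrite addnS ffactSS expnS leq_mul // ltnS leq_addr.
by rewrite -bin_ffact mulnC -mulnA leq_mul2l -expnD addnC bin_le_exp2 orbT.
Qed.

(** * Exponents whose negated ray sum falls in a given cone *)

Section OneCone.
Variables (n d : nat) (nv : 'I_n -> 'I_d -> int) (s : {set 'I_n}) (u : 'I_n -> 'I_d -> int).
Hypothesis us : dual_basis nv s u.
Variable L : nat.
Local Notation point := {ffun 'I_n -> 'I_L.+1}.
Implicit Types k : point.

Definition in_cone_part k : bool :=
  [forall (rho | rho \in s), 0 <= bcoord nv u (nt k) rho] &&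
  ((total (nt k))%:Z + \sum_(rho in s) bcoord nv u (nt k) rho <= L%:Z).

Lemma in_cone_partP k : in_cone_part k ->
  (forall rho, rho \in s -> bcoord nv u (nt k) rho = (absz (bcoord nv u (nt k) rho))%:Z) /\
  (total (nt k) + \sum_(rho in s) absz (bcoord nv u (nt k) rho) <= L)%N.
Proof.
move=> /andP[/forall_inP pos le].
have E rho : rho \in s -> bcoord nv u (nt k) rho = (absz (bcoord nv u (nt k) rho))%:Z.
  by move=> /pos b0; rewrite gez0_abs.
split=> //; move: le; rewrite (eq_bigr _ E) -(big_morph Posz PoszD (erefl _)).
by rewrite -PoszD lez_nat.
Qed.

(** For [r] in [s], [bcoord] is [- k r] plus a linear form in the coordinates off [s], so it
    determines [k r]. *)
Lemma point_eq k k' : (forall r, r \notin s -> k r = k' r) ->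
  (forall r, r \in s -> bcoord nv u (nt k) r = bcoord nv u (nt k') r) -> k = k'.
Proof.
move=> off on; apply/ffunP => r; apply: val_inj; have [rs|/off->//] := boolP (r \in s).
have := on r rs; rewrite !(bcoord_offbasis us) //.
rewrite (eq_bigr (fun i => (k' i)%:Z * pairing (u r) (nv i))) => [|i /off->//].
by move=> /addIr/oppr_inj/(congr1 absz).
Qed.

Definition slack k : nat := L - (total (nt k) + \sum_(rho in s) absz (bcoord nv u (nt k) rho)).

(** The index [r1] receives the [slack], so that on [in_cone_part] the coordinates in [r1 |: s] add
    up to exactly [L - total k]. Elsewhere [pin r = Some r0] makes index [r] record [k r0], the
    coordinate to be frozen. *)
Definition change_var (r1 : 'I_n) (pin : 'I_n -> option 'I_n) k : point :=
  [ffun r => inord (if r \in s then absz (bcoord nv u (nt k) r)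
                    else if r == r1 then slack k
                    else if pin r is Some r0 then k r0 else k r)].

Lemma change_varE r1 pin k r : in_cone_part k ->
  change_var r1 pin k r = (if r \in s then absz (bcoord nv u (nt k) r)
                    else if r == r1 then slack k
                    else if pin r is Some r0 then k r0 else k r) :> nat.
Proof.
move=> /in_cone_partP[_ le]; rewrite ffunE inordK // ltnS.
case: ifP => rs; last first.
  case: ifP => _; first exact: leq_subr.
  by case: (pin r) => [r0|]; rewrite -ltnS.
by move: le; rewrite (bigD1 r) //=; lia.
Qed.

Lemma change_var_total r1 pin k : r1 \notin s -> in_cone_part k ->
  (total (nt k) + \sum_(r in r1 |: s) change_var r1 pin k r <= L)%N.
Proof.
move=> r1s kP; rewrite big_setU1 //= change_varE // (negbTE r1s) eqxx.
rewrite (eq_bigr (fun r => absz (bcoord nv u (nt k) r))) => [|r rs]; last by rewrite change_varE // rs.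
by have [_ le] := in_cone_partP kP; rewrite addnCA /slack subnK.
Qed.

(** Equal slack and equal cone coordinates force equal [total], hence equal height exponents: one
    linear equation for the coordinates off [s]. *)
Lemma change_var_inj_aux r1 pin k k' : r1 \notin s -> in_cone_part k -> in_cone_part k' ->
  change_var r1 pin k = change_var r1 pin k' ->
  [/\ forall r, r \in s -> bcoord nv u (nt k) r = bcoord nv u (nt k') r,
      \sum_r acoef nv s r * (k r)%:Z = \sum_r acoef nv s r * (k' r)%:Z
    & forall r, r \notin s -> r != r1 ->
        if pin r is Some r0 then k r0 = k' r0 :> nat else k r = k' r :> nat].
Proof.
move=> r1s kP k'P eqc.
have E r : change_var r1 pin k r = change_var r1 pin k' r :> nat by rewrite eqc.
have [kE kL] := in_cone_partP kP; have [k'E k'L] := in_cone_partP k'P.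
have b_eq r : r \in s -> bcoord nv u (nt k) r = bcoord nv u (nt k') r.
  by move=> rs; have := E r; rewrite !change_varE // rs => bE; rewrite kE // k'E // bE.
split=> // [|r rs rr1]; last first.
  by have := E r; rewrite !change_varE // (negbTE rs) (negbTE rr1); case: (pin r).
have := E r1; rewrite !change_varE // (negbTE r1s) eqxx /slack => sE.
rewrite !(sum_acoef us) (eq_bigr _ b_eq); congr (Posz _ + _).
have S : (\sum_(r in s) absz (bcoord nv u (nt k) r) = \sum_(r in s) absz (bcoord nv u (nt k') r))%N.
  by apply: eq_bigr => r rs; rewrite b_eq.
move: kL k'L sE; rewrite S /total; move: (\sum_(r in s) _)%N (\sum_r _)%N (\sum_r _)%N => a b c.
by lia.
Qed.

(** The height exponent determines [k r1] once the other coordinates off [s] are known. Decay in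
    [#|s| + 1] directions leaves a power of [L + 1] equal to the Picard rank minus one. *)
Lemma cone_part_count r1 : r1 \notin s -> acoef nv s r1 != 0 ->
  (\sum_(k | in_cone_part k) 2 ^ total (nt k) <= 2 ^ L * 2 ^ #|s|.+1 * L.+1 ^ (n - #|s|.+1))%N.
Proof.
move=> r1s a1; have := @weighted_count n L in_cone_part (change_var r1 (fun=> None)) (r1 |: s) set0 0.
rewrite cardsU1 r1s cards0 subn0 /= add1n; apply.
- by rewrite -setI_eq0 setI0.
- move=> k k' kP k'P /(change_var_inj_aux r1s kP k'P)[b_eq aE eqk].
  have offr1 r : r \notin s -> r != r1 -> k r = k' r by move=> rs rr; apply/val_inj/eqk.
  apply: point_eq => // r rs; have [->|] := eqVneq r r1; last exact: offr1.
  move: aE; rewrite !(sum_acoef_offbasis us) (bigD1 r1) //= [RHS](bigD1 r1) //=.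
  rewrite (eq_bigr (fun i => acoef nv s i * (k' i)%:Z)) => [|i /andP[is_ ir]].
    by move=> /addIr/(mulfI a1)/(congr1 absz)/= ?; apply: val_inj.
  by rewrite offr1.
- by move=> k; apply: change_var_total.
- by move=> k r _; rewrite inE.
Qed.

(* On the points with given [bcoord], [k r0] is an affine function of the
   coordinates off [s]; these are its coefficients. *)
Definition bform r0 r : int :=
  if r0 \in s then - pairing (u r0) (nv r) else (r == r0)%:R.

Lemma bformE r0 (k : 'I_n -> nat) : (k r0)%:Z + (if r0 \in s then bcoord nv u k r0 else 0) =
  \sum_(r | r \notin s) bform r0 r * (k r)%:Z.
Proof.
rewrite /bform; case: ifP => rs.
  rewrite (bcoord_offbasis us) // addrA subrr add0r -sumrN.
  by apply: eq_bigr => r _; rewrite mulNr mulrC.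
rewrite addr0 (bigD1 r0) ?rs //= eqxx mul1r big1 ?addr0 // => r /andP[_ /negbTE ->].
by rewrite mul0r.
Qed.

Lemma cone_part_count_pinned r0 r1 r2 (j : nat) : r1 \notin s -> r2 \notin s -> 
  acoef nv s r1 * bform r0 r2 != acoef nv s r2 * bform r0 r1 ->
  (\sum_(k | in_cone_part k && (k r0 == j :> nat)) 2 ^ total (nt k)
     <= 2 ^ L * 2 ^ #|s|.+1 * L.+1 ^ (n - #|s|.+1 - 1))%N.
Proof.
move=> r1s r2s det.
have r12 : r1 != r2 by apply: contraNneq det => ->.
pose pin r := if r == r2 then Some r0 else None.
have := @weighted_count n L (fun k => in_cone_part k && (k r0 == j :> nat))
  (change_var r1 pin) (r1 |: s) [set r2] j.
rewrite cardsU1 r1s cards1 /= add1n; apply.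
- by rewrite disjoint_sym disjoints1 !inE negb_or eq_sym r12 r2s.
- move=> k k' /andP[kP /eqP kj] /andP[k'P /eqP k'j].
  move=> /(change_var_inj_aux r1s kP k'P)[b_eq aE eqk].
  have offr r : r \notin s -> r != r1 -> r != r2 -> k r = k' r.
    by move=> rs rr1 rr2; have := eqk r rs rr1; rewrite /pin (negbTE rr2) => /val_inj.
  have bE := bformE r0 (nt k); rewrite kj -k'j in bE.
  have {}bE : \sum_(r | r \notin s) bform r0 r * (k r)%:Z =
              \sum_(r | r \notin s) bform r0 r * (k' r)%:Z.
    by rewrite -bE -bformE; case: ifP => // /b_eq ->.
  have split2 (c : 'I_n -> int) (x : point) : \sum_(r | r \notin s) c r * (x r)%:Z =
     c r1 * (x r1)%:Z + c r2 * (x r2)%:Z +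
     \sum_(r | (r \notin s) && (r != r1) && (r != r2)) c r * (x r)%:Z.
    by rewrite (bigD1 r1) //= (bigD1 r2) /= ?addrA // r2s eq_sym.
  have rest (c : 'I_n -> int) :
      \sum_(r | (r \notin s) && (r != r1) && (r != r2)) c r * (k r)%:Z =
      \sum_(r | (r \notin s) && (r != r1) && (r != r2)) c r * (k' r)%:Z.
    by apply: eq_bigr => r /andP[/andP[rs rr1] rr2]; rewrite offr.
  move: aE bE; rewrite !(sum_acoef_offbasis us) !split2 !rest => /addIr aE /addIr bE.
  move: det aE bE; set a1 := acoef _ _ r1; set a2 := acoef _ _ r2.
  set b1 := bform _ r1; set b2 := bform _ r2 => det aE bE.
  have det' : a1 * b2 - a2 * b1 != 0 by rewrite subr_eq0.
  have E1 : (k r1)%:Z = (k' r1)%:Z.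
    apply: (mulfI det').
    transitivity (b2 * (a1 * (k r1)%:Z + a2 * (k r2)%:Z) - a2 * (b1 * (k r1)%:Z + b2 * (k r2)%:Z)).
      by ring.
    by rewrite aE bE; ring.
  have E2 : (k r2)%:Z = (k' r2)%:Z.
    apply: (mulfI det').
    transitivity (a1 * (b1 * (k r1)%:Z + b2 * (k r2)%:Z) - b1 * (a1 * (k r1)%:Z + a2 * (k r2)%:Z)).
      by ring.
    by rewrite aE bE; ring.
  apply: point_eq => // r rs.
  have [->|rr1] := eqVneq r r1; first by apply: val_inj; case: E1.
  have [->|rr2] := eqVneq r r2; first by apply: val_inj; case: E2.
  exact: offr.
- by move=> k /andP[kP _]; apply: change_var_total.
- move=> k r /andP[kP /eqP kj]; rewrite inE => /eqP->.
  by rewrite change_varE // (negbTE r2s) eq_sym (negbTE r12) /pin eqxx.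
Qed.

End OneCone.

Lemma leq_sum_cover (I J : finType) (P : pred I) (D : {set J}) (Q : J -> pred I) (F : I -> nat) :
  (forall i, P i -> exists2 s, s \in D & Q s i) ->
  (\sum_(i | P i) F i <= \sum_(s in D) \sum_(i | Q s i) F i)%N.
Proof.
move=> cover; rewrite (exchange_big_dep predT) //= big_mkcond leq_sum // => i _.
case: ifP => // /cover[s sD Qs]; rewrite (bigD1 s) ?sD //=; exact: leq_addr.
Qed.

(** * Volume bounds for the whole fan *)

Section Fan.
Variables (R : realType) (n d : nat) (nv : 'I_n -> 'I_d -> int) (Dmax : {set {set 'I_n}}).
Hypothesis fan : complete_regular_fan R nv Dmax.
Hypothesis gg : antican_gg nv Dmax.

Definition admissible (L : nat) (k : 'I_n -> nat) : bool :=
  [forall (s | s \in Dmax), \sum_r acoef nv s r * (k r)%:Z <= L%:Z].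

Lemma exists_dual_bases : exists U, forall s, s \in Dmax -> dual_basis nv s (U s).
Proof.
have [_ _ Zb _ _] := fan.
have ex (s : {set 'I_n}) : exists u, s \in Dmax -> dual_basis nv s u.
  have [/Zb/exists_dual_basis[u us]|_] := boolP (s \in Dmax); first by exists u.
  by exists (fun _ _ => 0).
by have [U UP] := choice ex; exists U.
Qed.

Lemma admissible_cone U L (k : 'I_n -> nat) :
  (forall s, s \in Dmax -> dual_basis nv s (U s)) ->
  admissible L k -> exists2 s, s \in Dmax &
    [forall (rho | rho \in s), 0 <= bcoord nv (U s) k rho] &&
    ((total k)%:Z + \sum_(rho in s) bcoord nv (U s) k rho <= L%:Z).
Proof.
move=> UP /forall_inP kL; have [s sD pos] := complete_dual (fun i => - \sum_r (k r)%:Z * nv r i) fan.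
exists s => //; apply/andP; split; last first.
  by have := kL s sD; rewrite (sum_acoef (UP s sD)).
apply/forall_inP => rho rs; have := pos _ (UP s sD) rho rs; congr (0 <= _).
rewrite (@pairing_sumr _ _ (index_enum 'I_n) xpredT _ (fun r => - (k r)%:Z) nv).
  by rewrite /bcoord -sumrN; apply: eq_bigr => r _; rewrite mulNr.
by move=> i; rewrite -sumrN; apply: eq_bigr => r _; rewrite mulNr.
Qed.

Lemma admissible_cover U L (k : {ffun 'I_n -> 'I_L.+1}) :
  (forall s, s \in Dmax -> dual_basis nv s (U s)) ->
  admissible L (nt k) -> exists2 s, s \in Dmax & in_cone_part nv s (U s) k.
Proof. exact: admissible_cone. Qed.

Lemma admissible_total L k : admissible L k -> (total k <= L)%N.
Proof.
move=> kL; have [U UP] := exists_dual_bases.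
have [s sD /andP[/forall_inP pos le]] := admissible_cone UP kL.
by rewrite -lez_nat (le_trans _ le) // lerDl sumr_ge0.
Qed.

Lemma bcoord_relation u (k : 'I_n -> nat) rho :
  (forall m, \sum_r (k r)%:Z * pairing m (nv r) = 0) -> bcoord nv u k rho = 0.
Proof. by move=> rel; rewrite /bcoord rel oppr0. Qed.

(** On a nonnegative relation involving [r0] every [bcoord] vanishes, so the height exponent equals
    [total k > 0]; some coefficient off [s] is then nonzero, and [gg] gives its sign. *)
Lemma exists_acoef_gt0 (r0 : 'I_n) s : s \in Dmax -> exists2 r1, r1 \notin s & 0 < acoef nv s r1.
Proof.
move=> sD; have [U UP] := exists_dual_bases; have us := UP s sD.
have [k [k0 rel]] := exists_relation r0 fan.
have [/exists_inP[r1 r1s a1]|] := boolP [exists (r | r \notin s), acoef nv s r != 0].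
  by exists r1 => //; rewrite lt0r a1 gg.
rewrite negb_exists_in => /forall_inP a0.
have := sum_acoef us k; rewrite (sum_acoef_offbasis us) big1 => [|r /a0/negPn/eqP->]; last first.
  by rewrite mul0r.
rewrite [X in _ + X]big1 => [|rho _]; last exact: bcoord_relation.
by rewrite addr0 (bigD1 r0) //=; lia.
Qed.

Lemma rank_pic_gt0 : (0 < n)%N -> (0 < rank_pic nv)%N.
Proof.
move=> n0; have [_ memD _ _ _] := fan; have [s sD _] := memD (Ordinal n0).
have [U UP] := exists_dual_bases; rewrite (rank_picE (UP s sD)) subn_gt0.
have [r1 r1s _] := exists_acoef_gt0 (Ordinal n0) sD.
rewrite -[X in (_ < X)%N]card_ord -[X in (X < _)%N]addn0.
by rewrite -(cardsC s) ltn_add2l; apply/card_gt0P; exists r1; rewrite inE.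
Qed.

(** When [bform] is proportional to [acoef], [k r0] plus its cone coordinate is a fixed multiple of
    [|k| + |c|]. A relation through [r0] shows the multiple to be positive, so a small [k r0] keeps
    [total] a fixed proportion below [L]. *)
Lemma total_le_dependent s u r0 r1 : s \in Dmax -> dual_basis nv s u -> r1 \notin s ->
  0 < acoef nv s r1 ->
  (forall r2, r2 \notin s -> acoef nv s r1 * bform nv s u r0 r2 = acoef nv s r2 * bform nv s u r0 r1) ->
  forall L (k : {ffun 'I_n -> 'I_L.+1}), in_cone_part nv s u k ->
  ((absz (acoef nv s r1)).+1 * total (nt k) <= absz (acoef nv s r1) * (L + k r0))%N.
Proof.
move=> sD us r1s; set a1 := acoef nv s r1 => a1_gt0 dep.
set b1 := bform nv s u r0 r1 in dep.
have key (k : 'I_n -> nat) : a1 * ((k r0)%:Z + (if r0 \in s then bcoord nv u k r0 else 0)) =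
    b1 * ((total k)%:Z + \sum_(rho in s) bcoord nv u k rho).
  rewrite (bformE us) -(sum_acoef us) (sum_acoef_offbasis us) !mulr_sumr.
  by apply: eq_bigr => r rs; rewrite mulrA dep // mulrA (mulrC b1).
have b1_gt0 : 0 < b1.
  have [k [k0 rel]] := exists_relation r0 fan; have := key k.
  rewrite big1 => [|rho _]; last exact: bcoord_relation.
  rewrite (bcoord_relation _ _ rel) if_same !addr0 => E.
  have : 0 < b1 * (total k)%:Z by rewrite -E mulr_gt0.
  by rewrite pmulr_lgt0 // ltz_nat /total (bigD1 r0) //= addn_gt0 k0.
move=> L k kP; have [bE le] := in_cone_partP kP; have := key (nt k).
rewrite (eq_bigr _ bE) -(big_morph Posz PoszD (erefl _)).
set c := (\sum_(rho in s) _)%N in le *.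
have : (if r0 \in s then bcoord nv u (nt k) r0 else 0) <= c%:Z.
  by case: ifP => // rs; rewrite bE // lez_nat /c (bigD1 r0) //= leq_addr.
set c0 := (if _ then _ else _); move: (total _) le => t le.
move: (nat_of_ord (k r0)) => j c0c E.
have [a aE] : exists a : nat, a1 = a%:Z by exists (absz a1); rewrite gtz0_abs.
rewrite aE in a1_gt0 E *; rewrite absz_nat.
(* Integrality turns [0 < b1] into [1 <= b1]. *)
have E1 : (t%:Z + c%:Z) <= a%:Z * (j%:Z + c%:Z).
  apply: (@le_trans _ _ (b1 * (t%:Z + c%:Z))).
    by rewrite ler_peMl // addr_ge0.
  by rewrite -E ler_wpM2l ?lerD2l // ltW.
have E2 : (t + c <= a * (j + c))%N by rewrite -lez_nat PoszM !PoszD.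
nia.
Qed.

Lemma admissible_count : exists C : nat, forall L,
  (\sum_(k : {ffun 'I_n -> 'I_L.+1} | admissible L (nt k)) 2 ^ total (nt k)
     <= C * (2 ^ L * L.+1 ^ (rank_pic nv - 1)))%N.
Proof.
have [U UP] := exists_dual_bases.
(* Without rays there is a single point, of weight 1. *)
case: (posnP n) => [n0|n0].
  exists 1%N => L; rewrite mul1n.
  apply: (@leq_trans 1); last by rewrite muln_gt0 !expn_gt0.
  apply: (@leq_trans (\sum_(k : {ffun 'I_n -> 'I_L.+1}) 1)%N).
    rewrite big_mkcond leq_sum // => k _; case: ifP => // _.
    by rewrite /total big1 // => r; case: r => r rn; exfalso; rewrite n0 in rn.
  by rewrite sum1_card card_ffun !card_ord n0.
exists (#|Dmax| * 2 ^ n.+1)%N => L.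
apply: leq_trans (leq_sum_cover _ (fun k => admissible_cover UP (k := k))) _.
rewrite -mulnA -sum_nat_const leq_sum // => s sD.
have [r1 r1s a1] := exists_acoef_gt0 (Ordinal n0) sD.
apply: leq_trans (cone_part_count (UP s sD) _ r1s (lt0r_neq0 a1)) _.
rewrite (rank_picE (UP s sD)) -subnDA addn1 mulnAC mulnC leq_mul2r leq_exp2l //.
by rewrite ltnS -[X in (_ <= X)%N]card_ord max_card orbT.
Qed.

Lemma pinned_count_one (r0 : 'I_n) s u : s \in Dmax -> dual_basis nv s u ->
  exists C : nat, forall L j, (2 ^ j <= 4 * L.+1 ^ 2)%N ->
  (L.+1 * \sum_(k : {ffun 'I_n -> 'I_L.+1} | in_cone_part nv s u k && (k r0 == j :> nat)) 2 ^ total (nt k)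
     <= C * (2 ^ L * L.+1 ^ (rank_pic nv - 1)))%N.
Proof.
move=> sD us; have [r1 r1s a1] := exists_acoef_gt0 r0 sD.
have rE := rank_picE us.
(* If the forms are independent, freezing [k r0] saves the factor [L + 1] outright. Otherwise
   [total] is at most [a / (a + 1) * (L + j)], an exponential gain. *)
have [/exists_inP[r2 r2s det]|] := boolP [exists (r2 | r2 \notin s),
    acoef nv s r1 * bform nv s u r0 r2 != acoef nv s r2 * bform nv s u r0 r1].
  exists (2 ^ n.+1)%N => L j _.
  have r12 : r1 != r2 by apply: contraNneq det => ->.
  have sn : (#|s| + 2 <= n)%N.
    have : (#|[set r1; r2] :|: s| <= n)%N by rewrite -[X in (_ <= X)%N]card_ord max_card.
    rewrite cardsU cards2 r12 (_ : _ :&: s = set0) ?cards0 ?subn0 1?addnC //.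
    apply/setP => r; rewrite !inE; apply/negbTE; rewrite negb_and negb_or.
    by have [rs|] := boolP (r \in s); rewrite ?orbT //= orbF; apply/andP; split;
       [apply: contraNneq r1s => <-|apply: contraNneq r2s => <-].
  apply: leq_trans (leq_mul (leqnn L.+1) (cone_part_count_pinned us L j r1s r2s det)) _.
  have -> : (rank_pic nv - 1 = (n - #|s|.+1 - 1).+1)%N by rewrite rE; lia.
  rewrite (expnS L.+1); set x := (L.+1 ^ _)%N; set y := (2 ^ L)%N; set z := (2 ^ #|s|.+1)%N.
  have -> : (L.+1 * (y * z * x) = z * (y * (L.+1 * x)))%N by ring.
  by rewrite leq_mul2r leq_exp2l // ltnS -[X in (_ <= X)%N]card_ord max_card orbT.
rewrite negb_exists_in => /forall_inP dep.
have le := total_le_dependent sD us r1s a1 (fun r2 r2s => eqP (negPn (dep r2 r2s))).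
set a := absz (acoef nv s r1) in le.
have a0 : (0 < a)%N by rewrite absz_gt0 lt0r_neq0.
(* For each point [n + 1] powers of [L + 1] are wanted: [n] for the number of points, one to be
   saved. The inequality is raised to the power [a + 1], and [2 ^ (a * j)] brings [2 * a] further
   powers and the factor [4 ^ a]. *)
pose A := (n.+1 * a.+1 + 2 * a)%N; pose C := (4 ^ a * (A`! * 2 ^ A))%N.
have C0 : (0 < C)%N by rewrite !muln_gt0 !expn_gt0 fact_gt0.
exists C => L j jL.
have one (k : {ffun 'I_n -> 'I_L.+1}) : in_cone_part nv s u k && (k r0 == j :> nat) ->
    (L.+1 ^ n.+1 * 2 ^ total (nt k) <= C * 2 ^ L)%N.
  move=> /andP[kP /eqP kj]; rewrite -(@leq_exp2r _ _ a.+1) // expnMn -!expnM.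
  have := le L k kP; rewrite kj (mulnC a.+1) => le1.
  apply: (@leq_trans (L.+1 ^ (n.+1 * a.+1) * (2 ^ (a * L) * (4 * L.+1 ^ 2) ^ a))%N).
    rewrite leq_mul2l; apply/orP; right.
    apply: (@leq_trans (2 ^ (a * (L + j)))); first by rewrite leq_exp2l.
    rewrite mulnDr expnD leq_mul2l; apply/orP; right.
    by rewrite mulnC expnM leq_exp2r.
  rewrite expnMn -expnM.
  have -> : (L.+1 ^ (n.+1 * a.+1) * (2 ^ (a * L) * (4 ^ a * L.+1 ^ (2 * a))) =
             4 ^ a * L.+1 ^ A * 2 ^ (a * L))%N.
    rewrite /A expnD; move: (L.+1 ^ (n.+1 * a.+1))%N (2 ^ (a * L))%N (4 ^ a)%N (L.+1 ^ (2 * a))%N.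
    by move=> x y z w; ring.
  apply: (@leq_trans (4 ^ a * (A`! * 2 ^ A * 2 ^ L) * 2 ^ (a * L))%N).
    by rewrite leq_mul2r leq_mul2l expn_le_exp2 !orbT.
  have -> : (4 ^ a * (A`! * 2 ^ A * 2 ^ L) * 2 ^ (a * L) = C * 2 ^ L * (2 ^ L) ^ a)%N.
    rewrite /C -expnM (mulnC L); move: (2 ^ L)%N (2 ^ (a * L))%N (4 ^ a)%N (A`!) (2 ^ A)%N.
    by move=> x y z w v; ring.
  rewrite expnS leq_mul2l; apply/orP; right.
  by rewrite leq_exp2r // leq_pmull.
rewrite -(leq_pmul2l (_ : 0 < L.+1 ^ n)%N) ?expn_gt0 //.
rewrite mulnA -expnSr big_distrr /=.
apply: (@leq_trans (\sum_(k : {ffun 'I_n -> 'I_L.+1} |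
  in_cone_part nv s u k && (k r0 == j :> nat)) C * 2 ^ L)); first exact: leq_sum.
rewrite sum_nat_const; apply: leq_mul; last first.
  by rewrite mulnA leq_pmulr // expn_gt0.
by rewrite (leq_trans (max_card _)) // card_ffun !card_ord.
Qed.

Lemma pinned_count : exists C : nat, forall (r0 : 'I_n) L j, (2 ^ j <= 4 * L.+1 ^ 2)%N ->
  (L.+1 * \sum_(k : {ffun 'I_n -> 'I_L.+1} | admissible L (nt k) && (k r0 == j :> nat)) 2 ^ total (nt k)
     <= C * (2 ^ L * L.+1 ^ (rank_pic nv - 1)))%N.
Proof.
have [U UP] := exists_dual_bases.
have /choice[C CP] : forall p : 'I_n * {set 'I_n}, exists C : nat, p.2 \in Dmax ->
    forall L j, (2 ^ j <= 4 * L.+1 ^ 2)%N ->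
  (L.+1 * \sum_(k : {ffun 'I_n -> 'I_L.+1} |
              in_cone_part nv p.2 (U p.2) k && (k p.1 == j :> nat)) 2 ^ total (nt k)
     <= C * (2 ^ L * L.+1 ^ (rank_pic nv - 1)))%N.
  move=> [r0 s] /=; have [sD|_] := boolP (s \in Dmax); last by exists 0%N.
  by have [C CP] := pinned_count_one r0 sD (UP s sD); exists C.
exists (\sum_r \sum_(s in Dmax) C (r, s))%N => r0 L j jL.
apply: (@leq_trans (L.+1 * \sum_(s in Dmax) \sum_(k : {ffun 'I_n -> 'I_L.+1} |
              in_cone_part nv s (U s) k && (k r0 == j :> nat)) 2 ^ total (nt k))%N).
  rewrite leq_mul2l; apply/orP; right; apply: leq_sum_cover => k /andP[kA kj].
  by have [s sD ks] := admissible_cover UP kA; exists s; rewrite // ks.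
rewrite big_distrr /= (bigD1 r0) //= mulnDl.
apply: leq_trans (leq_addr _ _); rewrite big_distrl /= leq_sum // => s sD.
exact: (CP (r0, s)).
Qed.

End Fan.

(** * From multivariate to iterated polynomials *)

Lemma zeval_map (S S' : comNzRingType) (g : {rmorphism S -> S'}) n X (f : zpoly n) :
  zeval n (map g X) f = g (zeval n X f).
Proof.
elim: n X f => [|n IH] X f; first by rewrite /= rmorph_int.
rewrite /= /horner_eval -horner_map -map_poly_comp.
have -> : head 0 (map g X) = g (head 0 X) by case: X => //=; rewrite rmorph0.
congr (_.[_]); apply: eq_map_poly => c; rewrite /= -IH; congr (zeval n _ _).
by case: X.
Qed.

Fixpoint zvars (n : nat) : seq (zpoly n) :=
  match n return seq (zpoly n) with
  | 0%N => [::]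
  | m.+1 => ('X : {poly zpoly m}) :: [seq (c%:P : {poly zpoly m}) | c <- zvars m]
  end.

Lemma size_zvars n : size (zvars n) = n.
Proof. by elim: n => [|n IH] //=; rewrite size_map IH. Qed.

Lemma zeval_zvars n (f : zpoly n) : zeval n (zvars n) f = f.
Proof.
elim: n f => [|n IH] f; first exact: intz.
rewrite /= /horner_eval.
rewrite (eq_map_poly (g := polyC)) => [|c]; last first.
  by rewrite (zeval_map (@polyC (zpoly n))) IH.
exact: comp_polyXr.
Qed.

Lemma zeval_nth_zvars (S : comNzRingType) n (X : seq S) i : (i < n)%N ->
  zeval n X (nth 0 (zvars n) i) = nth 0 X i.
Proof.
elim: n X i => // n IH X [|i] lt /=.
  by rewrite /horner_eval map_polyX hornerX; case: X.
rewrite (nth_map 0) ?size_zvars // /horner_eval map_polyC hornerC.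
rewrite /= IH //.
by case: X => //=; rewrite nth_nil.
Qed.

Section Transfer.
Variable n : nat.
Implicit Types f g h : {mpoly int[n]}.

Definition zpoly_of_mpoly : {rmorphism {mpoly int[n]} -> zpoly n} :=
  mmap (intr : {rmorphism int -> zpoly n}) (fun i : 'I_n => nth 0 (zvars n) i).

Lemma zeval_zpoly_of_mpoly (S : comNzRingType) (X : seq S) f :
  zeval n X (zpoly_of_mpoly f) = mmap (intr : {rmorphism int -> S}) (fun i : 'I_n => nth 0 X i) f.
Proof.
rewrite /zpoly_of_mpoly /= /mmap rmorph_sum; apply: eq_bigr => m _.
rewrite rmorphM /= rmorph_int; congr (_ * _); rewrite /mmap1 rmorph_prod.
by apply: eq_bigr => i _; rewrite rmorphXn /= zeval_nth_zvars.
Qed.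

Lemma zval_zpoly_of_mpoly (X : {ffun 'I_n -> nat}) f :
  zval [seq X i | i <- enum 'I_n] (zpoly_of_mpoly f) = evalZ f X.
Proof.
rewrite /zval zeval_zpoly_of_mpoly /evalZ mevalE /mmap; apply: eq_bigr => m _.
rewrite /= intz; congr (_ * _); apply: eq_bigr => i _; congr (_ ^+ _).
by rewrite -map_comp (nth_map i) ?size_enum_ord // nth_ord_enum.
Qed.

Definition mpoly_of_zpoly : {rmorphism zpoly n -> {mpoly int[n]}} :=
  zeval n [seq ('X_i : {mpoly int[n]}) | i <- enum 'I_n].

Lemma zpoly_of_mpolyK f : mpoly_of_zpoly (zpoly_of_mpoly f) = f.
Proof.
rewrite /mpoly_of_zpoly zeval_zpoly_of_mpoly {2}[f]mpolyE /mmap.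
apply: eq_bigr => m _; rewrite -mul_mpolyC /= -[LHS]/(_%:~R * _).
congr (_ * _); first by rewrite -[in RHS](intz f@_m) rmorph_int.
rewrite mpolyXE_id; apply: eq_bigr => i _; congr (_ ^+ _).
by rewrite (nth_map i) ?size_enum_ord // nth_ord_enum.
Qed.

Lemma mpoly_of_zpolyK (h : zpoly n) : zpoly_of_mpoly (mpoly_of_zpoly h) = h.
Proof.
rewrite /mpoly_of_zpoly -zeval_map -[RHS]zeval_zvars; congr (zeval n _ _).
apply: (@eq_from_nth _ 0) => [|i]; rewrite -map_comp size_map size_enum_ord ?size_zvars // => lt.
rewrite (nth_map (Ordinal lt)) ?size_enum_ord //= mmapX mmap1U.
by rewrite nth_enum_ord.
Qed.

(** A common divisor is transported to the multivariate ring and then to rational coefficients,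
    where it must be constant; since integers embed in the rationals, it was constant already. *)
Lemma zcoprime_of_mpoly f g : coprime_mpoly f g ->
  zcoprime [:: zpoly_of_mpoly f; zpoly_of_mpoly g].
Proof.
move=> cop h hd.
have dvd f' : rdvd h (zpoly_of_mpoly f') -> exists q,
    map_mpoly (intr : int -> rat) f' = map_mpoly (intr : int -> rat) (mpoly_of_zpoly h) * q.
  move=> [q /(congr1 mpoly_of_zpoly)]; rewrite zpoly_of_mpolyK rmorphM => ->.
  exists (map_mpoly (intr : int -> rat) (mpoly_of_zpoly q)).
  by rewrite -(rmorphM (map_mpoly (intr : {rmorphism int -> rat}))) mulrC.
have [|q1 q1E] := dvd f; first by apply: hd; rewrite mem_head.
have [|q2 q2E] := dvd g; first by apply: hd; rewrite !inE eqxx orbT.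
have := msize1_polyC (cop _ _ _ q1E q2E).
set h' := mpoly_of_zpoly h => hE.
exists (h'@_0); rewrite -[h]mpoly_of_zpolyK -/h'.
have hC : h' = (h'@_0)%:MP.
  apply/mpolyP => m; rewrite mcoeffC; have := congr1 (mcoeff m) hE.
  rewrite mcoeffC mcoeff_map_mpoly mcoeff_map_mpoly; case: eqP => [<-|_]; first by move=> _; rewrite mulr1.
  by rewrite !mulr0 => /eqP; rewrite intr_eq0 => /eqP.
by rewrite {1}hC /zpoly_of_mpoly /= mmapC.
Qed.

(** If both polynomials vanished, a variable would be a nonconstant common divisor. *)
Lemma has_zpoly_of_mpoly f g : (0 < n)%N -> coprime_mpoly f g ->
  has (predC1 0) [:: zpoly_of_mpoly f; zpoly_of_mpoly g].
Proof.
move=> n0 cop; apply/negPn/negP => /hasPn no.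
have zero f' : zpoly_of_mpoly f' \in [:: zpoly_of_mpoly f; zpoly_of_mpoly g] -> f' = 0.
  by move=> /no/negPn/eqP E; rewrite -[f']zpoly_of_mpolyK E rmorph0.
have := cop 'X_(Ordinal n0) 0 0.
rewrite (zero f) ?mem_head // (zero g) ?inE ?eqxx ?orbT // mulr0.
rewrite (rmorph0 (map_mpoly (intr : {rmorphism int -> rat}))) => /(_ erefl erefl).
by rewrite msizeX mdeg1.
Qed.
End Transfer.
Arguments zpoly_of_mpoly {n}.

(** * Counting points of bounded height *)

Section Dyadic.
Variable n : nat.

Definition dyadic (X : {ffun 'I_n -> nat}) (r : 'I_n) : nat := trunc_log 2 (X r).

Lemma dyadic_bounds (X : {ffun 'I_n -> nat}) r : (0 < X r)%N -> (2 ^ dyadic X r <= X r < 2 ^ (dyadic X r).+1)%N.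
Proof. by move=> X0; apply: trunc_log_bounds. Qed.

Definition coords (X : {ffun 'I_n -> nat}) : seq nat := [seq X i | i <- enum 'I_n].

Lemma coords_inj : injective coords.
Proof.
move=> X Y /eq_in_map eqXY; apply/ffunP => i.
by apply: eqXY; rewrite mem_enum.
Qed.

(** The dyadic box is enlarged to start at 0, which costs a factor [2 ^ n] in volume. *)
Definition dyadic_box (k : 'I_n -> nat) : seq nat := [seq (2 ^ (k i).+1)%N | i <- enum 'I_n].

Lemma prod_dyadic_box k : (\prod_(t <- dyadic_box k) t = 2 ^ n * 2 ^ total k)%N.
Proof.
rewrite big_map big_enum /= -expn_sum /total -expnD; congr (2 ^ _)%N.
under eq_bigr do rewrite -addn1.
by rewrite big_split /= sum_nat_const card_ord muln1 addnC.
Qed.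

Lemma count_dyadic_box (P : pred (seq nat)) (S : seq {ffun 'I_n -> nat}) (k : 'I_n -> nat) :
  uniq S -> (forall X, X \in S -> P (coords X) /\ forall r, 0 < X r)%N ->
  (count (fun X => [forall r, dyadic X r == k r]) S <= count P (box (dyadic_box k)))%N.
Proof.
move=> uS SP; rewrite -!size_filter -(size_map coords); apply: uniq_leq_size.
  by rewrite (map_inj_uniq coords_inj) filter_uniq.
move=> Y /mapP[X]; rewrite mem_filter => /andP[/forallP kX XS] ->.
have [PX X0] := SP X XS; rewrite mem_filter PX /=.
apply: mem_box => [|i]; first by rewrite !size_map.
rewrite size_map size_enum_ord => lt; rewrite /coords /dyadic_box.
rewrite !(nth_map (Ordinal lt)) -?enumT ?size_enum_ord //.
set i' := nth _ _ _; rewrite -(eqP (kX i')).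
by have /andP[] := dyadic_bounds (X0 i').
Qed.

Lemma size_dyadic_sum L (S : seq {ffun 'I_n -> nat}) :
  (forall X, X \in S -> forall r, dyadic X r <= L)%N ->
  (size S = \sum_(k : {ffun 'I_n -> 'I_L.+1}) count (fun X => [forall r, dyadic X r == k r]) S)%N.
Proof.
move=> SL; under eq_bigr do rewrite -sum_nat_of_bool.
rewrite exchange_big /= -sum1_size big_seq [RHS]big_seq; apply: eq_bigr => X XS.
pose k0 : {ffun 'I_n -> 'I_L.+1} := [ffun r => inord (dyadic X r)].
have k0E r : k0 r = dyadic X r :> nat by rewrite ffunE inordK // ltnS SL.
rewrite (bigD1 k0) //= [X in (X + _)%N](_ : _ = 1%N); last first.
  by apply/eqP; rewrite eqb1; apply/forallP => r; rewrite k0E.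
rewrite big1 // => k kk0; apply/eqP; rewrite eqb0; apply: contra kk0 => /forallP kX.
by apply/eqP/ffunP => r; apply: val_inj; rewrite /= k0E (eqP (kX r)).
Qed.

End Dyadic.

(** The exponents are nonnegative, so the height monomials only decrease when [X] is replaced by
    [2 ^ dyadic X]. *)
Lemma inA_admissible (R : realType) n d (nv : 'I_n -> 'I_d -> int) Dmax (B : R) X L :
  antican_gg nv Dmax -> B < 2 ^+ L.+1 -> inA R nv Dmax B X -> admissible nv Dmax L (dyadic X).
Proof.
move=> gg BL [X1 hX]; apply/forall_inP => s sD.
pose m r := absz (acoef nv s r).
have mE r : acoef nv s r = (m r)%:Z by rewrite /m gez0_abs // gg.
have -> : \sum_r acoef nv s r * (dyadic X r)%:Z = (\sum_r dyadic X r * m r)%N%:Z.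
  rewrite (big_morph Posz PoszD (erefl _)); apply: eq_bigr => r _.
  by rewrite mE -PoszM mulnC.
rewrite lez_nat -ltnS -(@ltn_exp2l 2) // -(ltr_nat R) [ltRHS]natrX (le_lt_trans _ BL) //.
apply: le_trans hX; apply: (@le_trans _ _ (XD0 R nv s X)); last exact: le_bigmax_cond.
have -> : XD0 R nv s X = (\prod_r X r ^ m r)%N%:R.
  by rewrite natr_prod; apply: eq_bigr => r _; rewrite mE natrX.
rewrite ler_nat expn_sum; apply: leq_prod => r _; rewrite expnM.
have /andP[le _] := dyadic_bounds (X1 r).
by case: (m r) => // e; rewrite leq_exp2r.
Qed.

Section Assembly.
Variables (R : realType) (n d : nat) (nv : 'I_n -> 'I_d -> int) (Dmax : {set {set 'I_n}}).
Variables (f g : {mpoly int[n]}).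
Hypothesis n0 : (0 < n)%N.
Hypothesis fan : complete_regular_fan R nv Dmax.
Hypothesis gg : antican_gg nv Dmax.
Hypothesis cop : coprime_mpoly f g.
Local Notation rk := (rank_pic nv).
(** Boxes with an exponent at most [J] are counted in full by [pinned_count], the others sieved with
    [m = 2 ^ J]. The lower bound on [2 ^ J] makes the sieve error at most [1 / (L + 1)]; the upper
    bound is what [pinned_count] requires. *)
Lemma dyadic_count : exists C : nat, forall (B N : R) L J, (0 < L)%N -> 2 <= N ->
  B < 2 ^+ L.+1 -> (L.+1 ^ 2 <= 2 ^ J)%N -> (2 ^ J <= 4 * L.+1 ^ 2)%N ->
  forall S : seq {ffun 'I_n -> nat}, uniq S ->
    (forall X, X \in S -> inA R nv Dmax B X /\
       exists p : nat, [/\ prime p, N <= p%:R & (p%:Z %| gcdz (evalZ f X) (evalZ g X))%Z]) ->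
  (size S)%:R <= C%:R * (2 ^+ L * L.+1%:R ^+ (rk - 1)
                         * ((N * ln N)^-1 + J.+1%:R / L.+1%:R)) :> R.
Proof.
pose F := [:: zpoly_of_mpoly f; zpoly_of_mpoly g].
have [c cP] := box_sieve R (has_zpoly_of_mpoly n0 cop) (zcoprime_of_mpoly cop).
have [C1 C1P] := admissible_count fan gg.
have [C2 C2P] := pinned_count fan gg.
exists (2 ^ n * (n * C2) + 16 * c * 2 ^ n * C1)%N => B N L J L0 N2 BL JL JU S uS SP.
have N0 : 0 < N * ln N by rewrite mulr_gt0 ?ln_gt0 //; lra.
pose Q p := N <= p%:R.
pose small (k : {ffun 'I_n -> 'I_L.+1}) := [exists r, (k r <= J)%N].
set M := (2 ^ L * L.+1 ^ (rk - 1))%N in C1P C2P.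
pose T := (N * ln N)^-1; have T0 : 0 < T by rewrite invr_gt0.
have X0 X : X \in S -> forall r, (0 < X r)%N by move=> /SP[[X1 _] _] r'; apply: X1.
have adm X : X \in S -> admissible nv Dmax L (dyadic X).
  by move=> /SP[XA _]; apply: inA_admissible XA.
have large X : X \in S -> has_large_prime Q F (coords X).
  move=> /SP[_ [p [pp Np]]]; rewrite dvdz_gcd => /andP[pf pg].
  by apply/asboolP; exists p; split=> //=; rewrite !zval_zpoly_of_mpoly pf pg.
have SL X : X \in S -> forall r, (dyadic X r <= L)%N.
  move=> XS r'; apply: leq_trans (admissible_total fan (adm X XS)).
  by rewrite /total (bigD1 r') //= leq_addr.
pose cnt (k : {ffun 'I_n -> 'I_L.+1}) := count (fun X => [forall r, dyadic X r == nt k r]) S.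
have cnt_le k : (cnt k <= 2 ^ n * 2 ^ total (nt k))%N.
  rewrite -prod_dyadic_box -size_box -count_predT.
  by apply: count_dyadic_box => // X XS; split=> //; apply: X0.
have cnt_large k : ~~ small k ->
    (cnt k)%:R <= (16 * c * 2 ^ n * 2 ^ total (nt k))%N%:R * (T + L.+1%:R^-1) :> R.
  rewrite negb_exists => /forallP kJ.
  apply: (@le_trans _ _ (count (has_large_prime Q F) (box (dyadic_box (nt k))))%:R).
    rewrite ler_nat; apply: count_dyadic_box => // X XS.
    by split; [apply: large | apply: X0].
  (* The sides are [2 ^ (k r + 1)], hence [L + 1] in place of [L]. *)
  apply: (le_trans (@cP Q (2 ^ J)%N L.+1 (dyadic_box (nt k)) _ _ _ _)) => //.
  - by rewrite expn_gt0.
  - by rewrite size_map size_enum_ord.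
  - apply/allP => _ /mapP[i _ ->]; rewrite !leq_exp2l //.
    by have := kJ i; have := ltn_ord (k i); lia.
  rewrite prod_dyadic_box -[X in _ <= X]/(_ * _).
  have le1 : prime_sum R Q (2 ^ J) <= 16 * T by apply: prime_sum_tail.
  have le2 : L.+1%:R / (2 ^ J)%N%:R <= L.+1%:R^-1 :> R.
    rewrite ler_pdivrMr ?ltr0n ?expn_gt0 // mulrC ler_pdivlMr ?ltr0n //.
    by rewrite -natrM ler_nat mulnn.
  set V := (2 ^ n * _)%N.
  apply: (@le_trans _ _ (c%:R * V%:R * (16 * T + L.+1%:R^-1))).
    by rewrite ler_wpM2l ?mulr_ge0 // lerD.
  have -> : (16 * c * 2 ^ n * 2 ^ total (nt k))%N = (16 * (c * V))%N by rewrite /V !mulnA.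
  rewrite (natrM _ 16) (natrM _ c); set x : R := c%:R * V%:R.
  have x0 : 0 <= x by rewrite mulr_ge0.
  have y0 : 0 <= L.+1%:R^-1 :> R by rewrite invr_ge0.
  have : 0 <= x * L.+1%:R^-1 by rewrite mulr_ge0.
  by set y : R := L.+1%:R^-1 => ?; lra.
have cnt0 k : ~~ admissible nv Dmax L (nt k) -> cnt k = 0%N.
  move=> nk; apply/eqP; rewrite -leqn0 leqNgt -has_count; apply/hasPn => X XS.
  apply: contra nk => /forallP kX; have := adm X XS.
  rewrite /admissible => /forall_inP aX; apply/forall_inP => s sD.
  have := aX s sD; rewrite (eq_bigr (fun r => acoef nv s r * (nt k r)%:Z)) // => r' _.
  by rewrite (eqP (kX r')).
(* A small [k] is charged to a pair of a coordinate and its value [j <= J], any other admissible [k]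
   to the sieve; both terms are nonnegative, so they may be summed over all [k]. *)
have split_k k : (cnt k)%:R <=
    (2 ^ n)%N%:R * (\sum_r \sum_(j < J.+1)
       (if admissible nv Dmax L (nt k) && (k r == j :> nat) then 2 ^ total (nt k) else 0))%N%:R
    + (if admissible nv Dmax L (nt k) then (16 * c * 2 ^ n * 2 ^ total (nt k))%N%:R else 0)
        * (T + L.+1%:R^-1) :> R.
  have TL0 : 0 <= T + L.+1%:R^-1 by rewrite addr_ge0 ?invr_ge0 // ltW.
  have [ak|/cnt0->] := boolP (admissible nv Dmax L (nt k)); last first.
    by rewrite mul0r addr0 mulr_ge0.
  have [sk|/cnt_large le] := boolP (small k); last first.
    by rewrite (le_trans le) // lerDr mulr_ge0.
  have [r' kJ] := existsP sk; have kJ' : (k r' < J.+1)%N by [].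
  rewrite -[leLHS]addr0 lerD ?mulr_ge0 // -natrM ler_nat (leq_trans (cnt_le k)) //.
  rewrite leq_mul2l (bigD1 r') //= (bigD1 (Ordinal kJ')) //= eqxx -addnA leq_addr orbT //.
rewrite (size_dyadic_sum SL) natr_sum.
apply: le_trans (ler_sum _ (fun k _ => split_k k)) _.
rewrite big_split /= -mulr_sumr -mulr_suml -natr_sum -big_mkcond /= -natr_sum.
rewrite (exchange_big_dep predT) //=.
set S1 := (\sum_(i < n) _)%N; set S2 := (\sum_(k | _) _)%N.
have S1le : (L.+1 * S1 <= n * C2 * M * J.+1)%N.
  rewrite /S1 big_distrr /=.
  apply: (@leq_trans (\sum_(i < n) \sum_(j < J.+1) C2 * M)%N); last first.
    by rewrite !sum_nat_const !card_ord; apply: eq_leq; ring.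
  apply: leq_sum => i _; rewrite exchange_big /= big_distrr /= leq_sum // => j _.
  rewrite -big_mkcond /=; apply: C2P; apply: leq_trans JU; rewrite leq_exp2l //.
  by rewrite -ltnS.
have S2le : (S2 <= 16 * c * 2 ^ n * (C1 * M))%N.
  by rewrite /S2 -big_distrr /= leq_mul2l C1P orbT.
have ME : M%:R = 2 ^+ L * L.+1%:R ^+ (rk - 1) :> R by rewrite /M natrM !natrX.
rewrite -ME -/T.
have L1 : 0 < L.+1%:R :> R by rewrite ltr0n.
have S1R : S1%:R <= (n * C2 * M)%N%:R * (J.+1%:R / L.+1%:R) :> R.
  by rewrite mulrA ler_pdivlMr // mulrC -!natrM ler_nat.
have S2R : S2%:R <= (16 * c * 2 ^ n * (C1 * M))%N%:R :> R by rewrite ler_nat.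
have iL : 0 < L.+1%:R^-1 :> R by rewrite invr_gt0.
have JLe : L.+1%:R^-1 <= J.+1%:R / L.+1%:R :> R by rewrite ler_peMl ?ler1n // ltW.
set w : R := L.+1%:R^-1 in iL JLe *; set z : R := J.+1%:R / L.+1%:R in S1R JLe *.
apply: (@le_trans _ _ ((2 ^ n)%N%:R * ((n * C2 * M)%N%:R * z) +
   (16 * c * 2 ^ n * (C1 * M))%N%:R * (T + z))).
  rewrite lerD // ?ler_wpM2l // ler_pM ?addr_ge0 //; [exact: ltW..|].
  by rewrite lerD2l.
rewrite (natrD _ (2 ^ n * (n * C2))) mulrDl lerD //.
  rewrite [leLHS]mulrA [leRHS]mulrA -!natrM !mulnA ler_wpM2l //.
  by rewrite lerDr ltW.
by rewrite [leRHS]mulrA -natrM !mulnA.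
Qed.
End Assembly.

(** * Choice of the dyadic scale and the final estimate *)

Local Notation expR := sequences.expR.

(** [L] is the integer part of [log_2 B], and [J] rounds up the logarithm of [(L + 1) ^ 2]. From
    [e ^ e] on, [ln (ln B) >= 1] absorbs additive constants. *)
Lemma dyadic_scale (R : realType) (B : R) : expR (expR 1) <= B ->
  exists L J : nat, [/\ (0 < L)%N, 2 ^+ L <= B, B < 2 ^+ L.+1,
     (L.+1 ^ 2 <= 2 ^ J)%N & (2 ^ J <= 4 * L.+1 ^ 2)%N] /\
  [/\ ln B <= L.+1%:R, L.+1%:R <= 4 * ln B & J.+1%:R <= 25 * ln (ln B)].
Proof.
move=> hB.
have B3 : 3 <= B.
  have := expR_ge1Dx (expR (1 : R)); have := expR_ge1Dx (1 : R); lra.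
have B0 : 0 < B by lra.
have e1 : expR 1 <= ln B.
  by rewrite -[leLHS]expRK ler_ln ?posrE ?expR_gt0.
have l0 : 0 < ln B by rewrite (lt_le_trans _ e1) // expR_gt0.
have ll1 : 1 <= ln (ln B).
  by rewrite -[leLHS]expRK ler_ln ?posrE ?expR_gt0.
have [ln2l ln2u] := ln2_bounds R.
have /andP[bB Bb] := truncn_itv (ltW B0); set b := Num.truncn B in bB Bb.
have b2 : (2 <= b)%N by rewrite /b truncn_ge_nat ?(ltW B0) //; lra.
pose L := trunc_log 2 b.
have L0 : (0 < L)%N by rewrite trunc_log_gt0.
have /andP[Lb bL] : (2 ^ L <= b < 2 ^ L.+1)%N by apply: trunc_log_bounds; rewrite // ltnW.
have LB : 2 ^+ L <= B.
  by apply: le_trans bB; rewrite -natrX ler_nat.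
have BL : B < 2 ^+ L.+1.
  by apply: lt_le_trans Bb _; rewrite -natrX ler_nat.
pose J := up_log 2 (L.+1 ^ 2).
have sq1 : (1 < L.+1 ^ 2)%N by rewrite (@leq_trans (2 ^ 2)) // leq_sqr.
have /andP[Jl Ju] := @up_log_bounds 2 (L.+1 ^ 2) isT sq1.
have J0 : (0 < J)%N by rewrite lt0n; apply/eqP => J0; move: Ju; rewrite -/J J0 leqNgt sq1.
have JU : (2 ^ J <= 4 * L.+1 ^ 2)%N.
  rewrite -(prednK J0) expnS (leq_trans (leq_mul (leqnn 2) (ltnW Jl))) //.
  by rewrite leq_mul2r orbT.
exists L, J; split=> //.
have lnX k : ln (2 ^+ k) = k%:R * ln 2 :> R by rewrite lnXn // mulr_natl.
have lnu : ln B <= L.+1%:R.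
  apply: (@le_trans _ _ (ln (2 ^+ L.+1))); first by rewrite ler_ln ?posrE ?exprn_gt0 // ltW.
  by rewrite lnX ler_piMr.
have lnl : L%:R * ln 2 <= ln B.
  by rewrite -lnX ler_ln ?posrE ?exprn_gt0.
have LR : 1 <= L%:R :> R by rewrite ler1n.
have L4 : L.+1%:R <= 4 * ln B by rewrite -natr1; nra.
split=> //.
(* This is the logarithm of [2 ^ J <= 4 * (L + 1) ^ 2 <= 4 ^ 3 * (ln B) ^ 2]. *)
have J4 : J%:R * ln 2 <= 3 * ln 4 + 2 * ln (ln B) :> R.
  rewrite -lnX; have -> : 3 * ln 4 + 2 * ln (ln B) = ln (4 ^+ 3 * ln B ^+ 2) :> R.
    by rewrite lnM ?posrE ?exprn_gt0 // !lnXn // !mulr_natl.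
  rewrite ler_ln ?posrE ?mulr_gt0 ?exprn_gt0 //.
  apply: (@le_trans _ _ (4 * L.+1%:R ^+ 2)).
    by rewrite -!natrX -natrM ler_nat.
  have : L.+1%:R ^+ 2 <= (4 * ln B) ^+ 2 by rewrite lerXn2r // nnegrE // mulr_ge0 // ltW.
  by rewrite exprMn; lra.
have ln4 : ln 4 <= 2 :> R.
  by rewrite (_ : 4 = 2 ^+ 2); [rewrite lnX; lra | rewrite expr2; lra].
have JR : 0 <= J%:R :> R by [].
by rewrite -natr1; nra.
Qed.

Lemma sqr_le_expR (R : realType) (x : R) : 0 <= x -> 4^-1 * x ^+ 2 <= expR x.
Proof.
move=> x0; have -> : 4^-1 * x ^+ 2 = (x / 2) ^+ 2 by field.
have -> : expR x = expR (x / 2) ^+ 2 by rewrite -expRM_natl; congr expR; field.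
have le := expR_ge1Dx (x / 2).
by rewrite lerXn2r ?nnegrE ?expR_ge0 //; lra.
Qed.

Lemma size_uniq_ffun_ord0 (T : choiceType) n (S : seq {ffun 'I_n -> T}) :
  n = 0%N -> uniq S -> (size S <= 1)%N.
Proof.
move=> n0; case: S => [|X [|Y S]] //= /and3P[XY _ _].
suff E : X = Y by rewrite E mem_head in XY.
by apply/ffunP => i; case: i => i lt; exfalso; rewrite n0 in lt.
Qed.

(** The cardinality is bounded through all duplicate-free lists of bad points, which also yields
    finiteness. *)
Theorem theorem8p1 (R : realType) (n d : nat) (nv : 'I_n -> 'I_d -> int)
    (Dmax : {set {set 'I_n}}) (f g : mpoly.mpoly n int) :
  complete_regular_fan R nv Dmax ->
  projective_fan nv Dmax ->
  antican_gg nv Dmax ->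
  coprime_mpoly f g ->
  let r := rank_pic nv in
  exists C : R, 0 < C /\ exists B0 : R, forall B N : R, B0 <= B -> 2 <= N ->
    forall S : seq {ffun 'I_n -> nat}, uniq S ->
      (forall X, X \in S -> inA R nv Dmax B X /\
         exists p : nat, [/\ prime p, N <= p%:R & (p%:Z %| gcdz (evalZ f X) (evalZ g X))%Z]) ->
      (size S)%:R <= C * (B * ln B ^ (r%:Z - 1) / (N * ln N)
                          + B * ln B ^ (r%:Z - 2) * ln (ln B)).
Proof.
move=> fan _ gg cop r.
have aux (B : R) : expR (expR 1) <= B -> 0 < B /\ 0 < ln B /\ 1 <= ln (ln B).
  move=> hB; have B0 : 0 < B by apply: lt_le_trans hB; apply: expR_gt0.
  have e1 : expR 1 <= ln B by rewrite -[leLHS]expRK ler_ln ?posrE ?expR_gt0.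
  have l0 : 0 < ln B by rewrite (lt_le_trans _ e1) // expR_gt0.
  by split=> //; split=> //; rewrite -[leLHS]expRK ler_ln ?posrE ?expR_gt0.
(* Without rays the Picard rank is 0 and there is at most one point, while [B / (ln B) ^ 2] is at
   least [1 / 4]. *)
have [n0|n0] := posnP n.
  have r0 : r = 0%N by apply/eqP; rewrite -leqn0; apply: leq_trans (leq_subr _ _) _; rewrite n0.
  exists 4; split=> //; exists (expR (expR 1)) => B N hB N2 S uS _.
  have [B0 [l0 ll]] := aux B hB.
  have NN : 0 < N * ln N by rewrite mulr_gt0 ?ln_gt0 //; lra.
  have fin (a b c : R) : 0 <= a -> 4^-1 <= b -> b <= c -> 1 <= 4 * (a + c) by lra.
  rewrite r0 !sub0r; apply: (@le_trans _ _ 1).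
    by rewrite (ler_nat R _ 1); apply: size_uniq_ffun_ord0 n0 uS.
  have t1 : 0 <= B * ln B ^ (-1) / (N * ln N).
    by rewrite divr_ge0 ?(ltW NN) // mulr_ge0 ?(ltW B0) // exprz_ge0 // ltW.
  have t2 : 4^-1 <= B * ln B ^ (-2).
    rewrite -[ln B ^ (-2)]/(ln B ^- 2) ler_pdivlMr ?exprn_gt0 //.
    by have := sqr_le_expR (ltW l0); rewrite lnK ?posrE.
  have t3 : B * ln B ^ (-2) <= B * ln B ^ (-2) * ln (ln B).
    by rewrite ler_peMr // (le_trans _ t2) ?invr_ge0.
  by apply: fin t2 t3.
have [C CP] := dyadic_count n0 fan gg cop.
have r0 : (0 < r)%N := rank_pic_gt0 fan gg n0.
(* The power of 4 comes from [L + 1 <= 4 * ln B], the 25 from the bound on [J + 1]; [C.+1] keeps [K]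
   positive. *)
pose K : R := 25 * (C.+1%:R * 4 ^+ (r - 1)).
have K0 : 0 < K by rewrite !mulr_gt0 ?exprn_gt0.
exists K; split=> //; exists (expR (expR 1)) => B N hB N2 S uS SP.
have [B0 [l0 ll]] := aux B hB.
have [L [J [[L0 LB BL JL JU] [lL L4 J25]]]] := dyadic_scale hB.
apply: le_trans (CP B N L J L0 N2 BL JL JU S uS SP) _.
have NN : 0 < N * ln N by rewrite mulr_gt0 ?ln_gt0 //; lra.
rewrite -/r; set l := ln B in l0 ll lL L4 J25 *.
have -> : l ^ (r%:Z - 1) = l ^+ (r - 1) by rewrite subzn.
(* For [r = 1] the exponent is negative, hence the division; [r - 1] is exact because [r] is
   positive. *)
have -> : l ^ (r%:Z - 2) = l ^+ (r - 1) / l.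
  rewrite (_ : r%:Z - 2 = (r - 1)%N%:Z - 1); last by rewrite -subzn // -addrA -opprD.
  by rewrite expfzDr ?lt0r_neq0.
have M_le : 2 ^+ L * L.+1%:R ^+ (r - 1) <= B * (4 ^+ (r - 1) * l ^+ (r - 1)).
  have l4 : 0 <= 4 * l by rewrite mulr_ge0 // ltW.
  by rewrite ler_pM ?exprn_ge0 // -exprMn lerXn2r // nnegrE.
have JL_le : J.+1%:R / L.+1%:R <= 25 * (ln l / l).
  by rewrite mulrA ler_pM ?invr_ge0 // lef_pV2 ?posrE.
set T := (N * ln N)^-1; have T0 : 0 <= T by rewrite invr_ge0 ltW.
set u : R := 4 ^+ (r - 1); have u0 : 0 <= u by rewrite exprn_ge0.
set v := l ^+ (r - 1); have v0 : 0 <= v by rewrite exprn_ge0 // ltW.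
set w := ln l / l in JL_le; have w0 : 0 <= w by rewrite divr_ge0 // ltW // (lt_le_trans _ ll).
have -> : K * (B * v * T + B * (v / l) * ln l) = C.+1%:R * ((B * (u * v)) * (25 * (T + w))).
  by rewrite /K /w -/u; field; rewrite lt0r_neq0.
apply: ler_pM => //.
- by rewrite mulr_ge0 ?exprn_ge0 //; [rewrite mulr_ge0 ?exprn_ge0 | rewrite addr_ge0 ?divr_ge0].
- by rewrite ler_nat.
apply: ler_pM => //.
- by rewrite mulr_ge0 ?exprn_ge0.
- by rewrite addr_ge0 // divr_ge0.
by rewrite mulrDr lerD // ler_peMl // ler1n.
Qed.
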